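(* Let $n\ge 1$ and let $S$ be an $n$-dimensional Clifford quantum polynomial algebra over $k$. Then $S$ is Calabi-Yau if and only if $n$ is odd.
   Context: $k$ is an algebraically closed field of characteristic $0$; all algebras are over $k$. For graded right modules $M,N$ over a connected graded algebra $S$, $\underline{\mathrm{Ext}}^i_S(M,N)=\bigoplus_{j\in\mathbb Z}\mathrm{Ext}^i_{\mathrm{grmod}\,S}(M,N(j))$, where $N(j)_i=N_{j+i}$; $H_S(t)=\sum_i(\dim_k S_i)t^i$. A noetherian connected graded algebra $S$ is an $n$-dimensional quantum polynomial algebra if $\mathrm{gldim}\,S=n$, $\underline{\mathrm{Ext}}^i_S(k,S)\cong k(n)$ for $i=n$ and $0$ for $i\neq n$, and $H_S(t)=(1-t)^{-n}$. The canonical module of an $n$-dimensional quantum polynomial algebra $S$ is the graded $S$-$S$-bimodule $\omega_S$ defined as the graded $k$-dual of $\varinjlim_{i}\underline{\mathrm{Ext}}^n_S(S/S_{\ge i},S)$. $S$ is Calabi-Yau if $\omega_S\cong S(-n)$ as graded $S$-$S$-bimodules. For a sequence $F=(F_1,\dots,F_n)$ of linearly independent symmetric matrices in $M_n(k)$, the graded Clifford algebra is $$C(F)=k\langle x_1,\dots,x_n,y_1,\dots,y_n\rangle/\Big(x_ix_j+x_jx_i-\sum_{m=1}^n(F_m)_{ij}y_m,\; x_iy_j-y_jx_i,\; y_iy_j-y_jy_i\Big)_{1\le i,j\le n},$$ with $\deg x_i=1$, $\deg y_j=2$. An $n$-dimensional Clifford quantum polynomial algebra is an $n$-dimensional quantum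 polynomial algebra that is isomorphic, as a graded algebra, to some $C(F)$. *)

(* Defs.v *)
From HB Require Import structures.
From mathcomp Require Import all_boot all_order all_algebra.
From mathcomp Require Import monalg.

Set Implicit Arguments.
Unset Strict Implicit.
Unset Printing Implicit Defensive.

Import GRing.Theory.
Local Open Scope ring_scope.

(* Rings.  Right S-modules are modules over the converse ring S^c, so the     *)
(* notions below are stated for left modules and used over both S and S^c.    *)

Section Rings.
Variable R : pzRingType.

Definition left_ideal (I : R -> Prop) :=
  I 0 /\ forall a x y, I x -> I y -> I (a * x + y).

Definition left_noetherian :=
  forall J : nat -> R -> Prop,
    (forall i, left_ideal (J i)) ->
    (forall i x, J i x -> J i.+1 x) ->
    exists N, forall i x, (N <= i)%N -> J i x -> J N x.

Definition projective (P : lmodType R) :=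
  forall (M N : lmodType R) (g : {linear M -> N}) (f : {linear P -> N}),
    (forall y, exists x, g x = y) ->
    exists h : {linear P -> M}, forall x, g (h x) = f x.

(* M has a projective resolution of length at most d, built one syzygy
   0 -> K -> P -> M -> 0 at a time. *)
Fixpoint pdim_le (d : nat) (M : lmodType R) : Prop :=
  if d is d'.+1 then
    exists (K P : lmodType R) (i : {linear K -> P}) (q : {linear P -> M}),
      [/\ projective P, injective i, forall y, exists x, q x = y,
          forall x, q x = 0 <-> exists z, x = i z & pdim_le d' K]
  else projective M.

Definition gldim_eq (n : nat) :=
  (forall M, pdim_le n M) /\ (forall m, (forall M, pdim_le m M) -> (n <= m)%N).

Definition ideal_gen (rel : R -> Prop) (x : R) :=
  forall I : R -> Prop,
    I 0 -> (forall u v, I u -> I v -> I (u + v)) ->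
    (forall a u b, I u -> I (a * u * b)) ->
    (forall u, rel u -> I u) -> I x.

End Rings.

Definition noetherian (R : pzRingType) :=
  left_noetherian R /\ left_noetherian R^c.

Definition dim_eq (k : fieldType) (V : lmodType k) (P : V -> Prop) (d : nat) :=
  exists b : 'I_d -> V, (forall t, P (b t)) /\
    forall v, P v -> exists! c : {ffun 'I_d -> k}, v = \sum_t c t *: b t.

Section GradedAlgebra.
Variables (k : fieldType) (S : algType k) (gr : nat -> S -> Prop).

Record connected_graded : Prop := ConnectedGraded {
  gr_zero : forall d, gr d 0;
  gr_lin : forall d c u v, gr d u -> gr d v -> gr d (c *: u + v);
  gr_span : forall a, exists (N : nat) (s : nat -> S),
    (forall d, gr d (s d)) /\ a = \sum_(d < N) s d;
  gr_direct : forall (N : nat) (s : nat -> S), (forall d, gr d (s d)) ->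
    \sum_(d < N) s d = 0 -> forall d, (d < N)%N -> s d = 0;
  gr_mul : forall d e u v, gr d u -> gr e v -> gr (d + e) (u * v);
  gr_conn : forall a, gr 0 a <-> exists c : k, a = c%:A;
  gr_nontrivial : 1 != 0 :> S }.

Definition grz (j : int) (a : S) : Prop :=
  if j is Posz d then gr d a else a = 0.

(* S_{>= i} *)
Definition tail (i : nat) (a : S) : Prop :=
  exists (N : nat) (s : nat -> S),
    (forall d, gr d (s d)) /\ a = \sum_(i <= d < N) s d.

(* H_S(t) = (1 - t)^(-n), i.e. (1 - t)^n * H_S(t) = 1 coefficientwise. *)
Definition hilbert_qpa (n : nat) :=
  exists h : nat -> nat, (forall i, dim_eq (gr i) (h i)) /\
    forall i : nat,
      \sum_(j < i.+1) ((1 - 'X) ^+ n : {poly int})`_j * (h (i - j)%N)%:R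
      = (i == 0)%:R.

(* Ext_S(S/I, S) for a graded right ideal I, computed by the graded-free bar
   resolution  ... -> S/I (x) S (x) S -> S/I (x) S -> S/I  (tensors over k).
   A right S-linear map S/I (x) S^(x)p (x) S -> S is a k-multilinear map
   f(m, a_1, ..., a_p) with m in S/I, i.e. with m in S and vanishing for m in I.
   Such an f is encoded as a function on sequences [:: m; a_1; ...; a_p]; only
   its values on sequences of size p+1 matter.  The differential is
     (df)(m, a_1, ..., a_(p+1)) =
        f(m a_1, a_2, ...) + \sum_(1 <= i <= p) (-1)^i f(m, .., a_i a_(i+1), ..)
        + (-1)^(p+1) f(m, a_1, ..., a_p) a_(p+1).                             *)

Definition cochain := seq S -> S.

Definition bar_diff (p : nat) (f : cochain) : cochain := fun l =>
  \sum_(i < p.+1)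
     (-1) ^+ i * f (take i l ++ (l`_i * l`_i.+1) :: drop i.+2 l)
  + (-1) ^+ p.+1 * (f (take p.+1 l) * l`_p.+1).

(* Degree j: a homogeneous map of degree 0 into S(j). *)
Record ext_cochain (I : S -> Prop) (p : nat) (j : int) (f : cochain) : Prop :=
  ExtCochain {
  cochain_lin : forall (c : k) u v s1 s2, (size s1 + size s2)%N = p ->
    f (s1 ++ (c *: u + v) :: s2) = c *: f (s1 ++ u :: s2) + f (s1 ++ v :: s2);
  cochain_ideal : forall m s, size s = p -> I m -> f (m :: s) = 0;
  cochain_deg : forall (s : seq S) (e : seq nat),
    size s = p.+1 -> size e = p.+1 ->
    (forall t, (t < p.+1)%N -> gr (nth 0%N e t) s`_t) ->
    grz (j + (sumn e)%:Z) (f s) }.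

Definition ext_cocycle I p j (f : cochain) :=
  ext_cochain I p j f /\ forall s, size s = p.+2 -> bar_diff p f s = 0.

Definition ext_coboundary I p j (f : cochain) :=
  if p is p'.+1 then
    exists2 g, ext_cochain I p' j g &
      forall s, size s = p.+1 -> f s = bar_diff p' g s
  else forall s, size s = 1%N -> f s = 0.

(* dim_k Ext^p_{grmod S}(S/I, S(j)) = d *)
Definition ext_dim I p j (d : nat) :=
  exists z : 'I_d -> cochain, (forall t, ext_cocycle I p j (z t)) /\
    forall f, ext_cocycle I p j f ->
      exists! c : {ffun 'I_d -> k},
        ext_coboundary I p j (fun s => f s - \sum_t c t *: z t s).

(* Here k = S/S_{>= 1}; an isomorphism of graded vector spaces with k(n), which
   is k placed in degree -n, amounts to equality of dimensions degreewise. *)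
Definition quantum_polynomial (n : nat) :=
  [/\ connected_graded, noetherian S, gldim_eq S^c n,
      forall p j, ext_dim (tail 1) p j ((p == n) && (j == - n%:Z))
    & hilbert_qpa n].

(* D = colim_i Ext^n_S(S/S_{>= i}, S).  On cochains the transition map induced
   by S/S_{>= i+1} -> S/S_{>= i} is the inclusion, so the degree j part of D is
   the space of all cocycles modulo the space of all coboundaries, i varying. *)
Definition colim_cocycle n j (f : cochain) :=
  exists i, ext_cocycle (tail i) n j f.
Definition colim_coboundary n j (f : cochain) :=
  exists i, ext_coboundary (tail i) n j f.

(* The S-S-bimodule structure of D: (a f b)(m, ...) = a f(b m, ...). *)
Definition colim_lact (a : S) (f : cochain) : cochain := fun s => a * f s.
Definition colim_ract (f : cochain) (b : S) : cochain :=
  fun s => f (b * head 0 s :: behead s).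

(* omega_S is the graded dual of D: (omega_S)_j consists of the linear forms on
   D_(-j), i.e. the linear forms on cocycles that vanish on coboundaries.  Two
   such functions are the same element if they agree on colim_cocycle n (- j),
   and (a phi b)(x) = phi (b x a). *)
Definition omega n (j : int) (phi : cochain -> k) : Prop :=
  (forall (c : k) f g, colim_cocycle n (- j) f -> colim_cocycle n (- j) g ->
     phi (fun s => c *: f s + g s) = c * phi f + phi g) /\
  (forall f, colim_cocycle n (- j) f -> colim_coboundary n (- j) f ->
     phi f = 0).

Definition omega_eq n (j : int) (phi psi : cochain -> k) : Prop :=
  forall f, colim_cocycle n (- j) f -> phi f = psi f.

Definition omega_lact (a : S) (phi : cochain -> k) : cochain -> k :=
  fun f => phi (colim_ract f a).
Definition omega_ract (phi : cochain -> k) (b : S) : cochain -> k :=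
  fun f => phi (colim_lact b f).

(* theta is an isomorphism S(-n) -> omega_S of graded S-S-bimodules; theta j is
   its component on S(-n)_j = S_(j - n). *)
Record omega_iso (n : nat) (theta : int -> S -> cochain -> k) : Prop :=
  OmegaIso {
  theta_omega : forall j a, grz (j - n%:Z) a -> omega n j (theta j a);
  theta_lin : forall j (c : k) a b, grz (j - n%:Z) a -> grz (j - n%:Z) b ->
    omega_eq n j (theta j (c *: a + b))
                 (fun f => c * theta j a f + theta j b f);
  theta_inj : forall j a, grz (j - n%:Z) a ->
    omega_eq n j (theta j a) (fun=> 0) -> a = 0;
  theta_surj : forall j phi, omega n j phi ->
    exists2 a, grz (j - n%:Z) a & omega_eq n j (theta j a) phi;
  theta_lact : forall j (d : nat) a b, grz (j - n%:Z) a -> gr d b ->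
    omega_eq n (j + d%:Z) (theta (j + d%:Z) (b * a))
                          (omega_lact b (theta j a));
  theta_ract : forall j (d : nat) a b, grz (j - n%:Z) a -> gr d b ->
    omega_eq n (j + d%:Z) (theta (j + d%:Z) (a * b))
                          (omega_ract (theta j a) b) }.

Definition calabi_yau (n : nat) := exists theta, omega_iso n theta.

End GradedAlgebra.

Section Clifford.
Variables (k : fieldType) (n : nat).

(* k<x_1, ..., x_n, y_1, ..., y_n> *)
Definition free_alg := {malg k[{fmonom ('I_n + 'I_n)%type}]}.

Definition gen_x (i : 'I_n) : free_alg := << fmu (inl i) >>.
Definition gen_y (i : 'I_n) : free_alg := << fmu (inr i) >>.

Inductive clifford_rel (F : n.-tuple 'M[k]_n) : free_alg -> Prop :=
| Clifford_xx i j : clifford_rel F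
    (gen_x i * gen_x j + gen_x j * gen_x i
       - \sum_(m < n) tnth F m i j *: gen_y m)
| Clifford_xy i j : clifford_rel F (gen_x i * gen_y j - gen_y j * gen_x i)
| Clifford_yy i j : clifford_rel F (gen_y i * gen_y j - gen_y j * gen_y i).

(* S is isomorphic to C(F) as a graded algebra: phi induces an isomorphism from
   the quotient of the free algebra by the ideal of relations onto S, and it is
   graded because it respects the degrees of the generators. *)
Definition iso_clifford (S : algType k) (gr : nat -> S -> Prop)
    (F : n.-tuple 'M[k]_n) :=
  exists phi : {lrmorphism free_alg -> S},
    [/\ forall a, exists w, phi w = a,
        forall w, phi w = 0 <-> ideal_gen (clifford_rel F) w,
        forall i, gr 1%N (phi (gen_x i))
      & forall i, gr 2 (phi (gen_y i))].

Definition clifford_quantum_polynomial (S : algType k) (gr : nat -> S -> Prop) :=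
  quantum_polynomial gr n /\
  exists F : n.-tuple 'M[k]_n,
    [/\ forall m, (tnth F m)^T = tnth F m, free F & iso_clifford gr F].

End Clifford.

(* Main.v *)
Require Import Defs.
From HB Require Import structures.
From mathcomp Require Import all_boot all_order all_algebra.
From mathcomp Require monalg.
From mathcomp Require Import mpoly zify.
From Stdlib Require Import Classical IndefiniteDescription FunctionalExtensionality.

(* Put D = colim_i Ext^n(S/S_{>= i}, S).  Since Ext^p(k, S) is k(n) for p = n and 0
   otherwise, D_(-n) is one-dimensional and f, a |-> f a is a perfect pairing
   D_(-n-d) x S_d -> D_(-n).  Hence omega_S is S(-n) with the left action twisted by an
   automorphism nu, determined by  x f ~ f nu(x)  for f in D_(-n-1) and x in S_1.

   The Hilbert series forces the ordered monomials in the x_i and y_i to be a basis, so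
   y_1, ..., y_n is a central regular sequence, and S/(y) is an exterior algebra.
   The identity of S/(y) is sent by the n
   connecting maps Ext^p(-, S/(y_1..y_r)) -> Ext^(p+1)(-, S/(y_1..y_(r-1))) to a class zeta
   in D_(-2n) with  a zeta ~ zeta a  for all a, and  a zeta ~ 0  exactly when a is in (y).
   Therefore D_(-n-1) = (S/(y))_(n-1) zeta, and moving x past n - 1 generators gives
   nu(x) = (-1)^(n-1) x. *)

Set Implicit Arguments.
Unset Strict Implicit.
Unset Printing Implicit Defensive.

Import GRing.Theory.
Local Open Scope ring_scope.

(** * The bar differential *)

(** All work is done on bar cochains, with classes compared through the layers S_N = S_{>= N}/S_{>=
    N+1}, which are sums of copies of k(-N). The pairing is perfect for three reasons: Ext^(n-1)(k,
    S) = 0 makes the transition maps of the colimit injective, Ext^(n+1)(k, S) = 0 lets a class on a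
    layer extend, and since Ext^n(k, S) sits in the single degree -n, only one layer can detect a
    class of given degree.

    The sign of nu cannot be read off this formal duality: it needs a class on which both actions
    can be computed. The class zeta serves because the y_i are central: the connecting maps then
    respect both actions, so zeta commutes with S as 1 does in S/(y). The bar resolution makes this
    explicit: its cochains are merely k-multilinear, so they may be composed with a k-linear
    division by y_i read off in coordinates.

    For n even, a bimodule isomorphism would send 1 to a form phi with phi(x f) = phi(f x), while
    nu(x) = -x gives phi(x f) = -phi(f x); in characteristic 0 this kills the image of x. For n odd,
    the residue D_(-n) -> k is a trace and defines the isomorphism. *)

Section BarDifferential.
Variables (k : fieldType) (S : algType k).
Implicit Types (f g : cochain S) (l s : seq S).

Lemma bar_diff0E f l :
  bar_diff 0 f l = f (l`_0 * l`_1 :: drop 2 l) - f (take 1 l) * l`_1.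
Proof.
by rewrite /bar_diff big_ord1 /= expr0 expr1 mul1r mulN1r take0.
Qed.

(** Fixing the first argument m turns f into a cochain of degree one less, whose own first argument
    takes the place of the module element. This recursion drives the inductions on p below. *)
Lemma bar_diffS p f m l :
  bar_diff p.+1 f (m :: l) =
    f (m * head 0 l :: behead l) - bar_diff p (fun s => f (m :: s)) l.
Proof.
rewrite /bar_diff big_ord_recl /= expr0 mul1r nth0 drop1 opprD addrA.
congr (_ + _ + _); last by rewrite [X in X * _]exprS mulN1r mulNr.
rewrite -sumrN; apply: eq_bigr => i _.
by rewrite /= /bump leq0n add1n exprS mulN1r mulNr.
Qed.

Lemma eq_bar_diff p f g l : (forall s, size s = p.+1 -> f s = g s) ->
  size l = p.+2 -> bar_diff p f l = bar_diff p g l.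
Proof.
move=> efg sl; rewrite /bar_diff efg ?size_takel ?sl //; congr (_ + _).
apply: eq_bigr => i _; congr (_ * _); apply: efg.
rewrite size_cat size_take /= size_drop sl !ltnS.
by have := ltn_ord i; rewrite ltnS => hi; rewrite ltnW ?ltnS // subSS addnS subSS subnKC.
Qed.

Lemma bar_diff_comb p c f g l :
  bar_diff p (fun s => c *: f s + g s) l = c *: bar_diff p f l + bar_diff p g l.
Proof.
rewrite /bar_diff scalerDr addrACA; congr (_ + _).
  rewrite scaler_sumr -big_split; apply: eq_bigr => i _ /=.
  by rewrite mulrDr scalerAr.
by rewrite mulrDl mulrDr -scalerAl -scalerAr.
Qed.

Lemma bar_diff_lact p b f l :
  bar_diff p (fun s => b * f s) l = b * bar_diff p f l.
Proof.
rewrite /bar_diff mulrDr mulr_sumr; congr (_ + _).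
  by apply: eq_bigr => i _; rewrite !mulrA (commr_sign b).
by rewrite !mulrA (commr_sign b).
Qed.

Lemma bar_diff_ract p f b m l :
  bar_diff p (colim_ract f b) (m :: l) = bar_diff p f (b * m :: l).
Proof.
case: p => [|p]; first by rewrite !bar_diff0E /colim_ract /= mulrA take0.
by rewrite !bar_diffS /colim_ract /= mulrA.
Qed.

(** By [bar_diffS], fixing the first argument m in df leaves f m - d(f(m, _)). The differential of
    the second term vanishes by induction, and that of f m cancels against the leading term by
    [bar_diff_ract]. *)
Lemma bar_diff_sq p f l : size l = p.+3 -> bar_diff p.+1 (bar_diff p f) l = 0.
Proof.
elim: p f l => [|p IHp] f [|m [|a [|b l]]] //= [sl].
  case: l sl => // _.
  rewrite bar_diffS !bar_diff0E /= !mulrBl !mulrA.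
  by rewrite (opprB (f [:: m * a] * b)) subrKA subrr.
rewrite bar_diffS /=; apply/eqP; rewrite subr_eq0; apply/eqP.
rewrite [RHS](@eq_bar_diff _ _ (fun s => - 1 *: bar_diff p (fun s => f (m :: s)) s
   + colim_ract f m s)) /= ?sl //.
  by rewrite bar_diff_comb IHp /= ?sl // scaler0 add0r bar_diff_ract.
by move=> [|c s] // _; rewrite bar_diffS /colim_ract /= scaleN1r addrC.
Qed.

Lemma bar_diff_ideal (J : S -> Prop) p f l :
  (forall c a b, J a -> J b -> J (c *: a + b)) -> (forall a b, J a -> J (a * b)) ->
  (forall s, size s = p.+1 -> J (f s)) -> size l = p.+2 -> J (bar_diff p f l).
Proof.
move=> Jlin Jmul Jf sl.
have J0 : J 0.
  have Ja := Jf _ (size_nseq p.+1 0).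
  by have := Jlin (-1) _ _ Ja Ja; rewrite scaleN1r addNr.
have JZ c a : J a -> J (c *: a) by move=> Ja; rewrite -[_ *: _]addr0; apply: Jlin.
have Jsgn i a : J a -> J ((-1) ^+ i * a).
  by rewrite -signr_odd; case: odd; rewrite ?expr0 ?expr1 ?mul1r // mulN1r -scaleN1r; apply: JZ.
have JD a b : J a -> J b -> J (a + b).
  by move=> Ja Jb; rewrite -[a]scale1r; apply: Jlin.
apply: (JD).
  apply: (big_ind J J0 JD) => i _; apply: (Jsgn); apply: Jf.
  rewrite size_cat size_take /= size_drop sl !ltnS.
  have := ltn_ord i; rewrite ltnS => hi.
  by rewrite ltnW ?ltnS // subSS addnS subSS subnKC.
by apply: Jsgn; apply: Jmul; apply: Jf; rewrite size_takel ?sl.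
Qed.

End BarDifferential.

(** * Coordinates in the monomial basis *)

(* mon sends 'X_[m] to the ordered monomial in which x_i occurs m_i mod 2 times and
   y_i occurs floor(m_i / 2) times, and co is its inverse: y_i acts as 'X_i ^+ 2. *)
Record pbw (k : fieldType) (S : algType k) (gr : nat -> S -> Prop) (n : nat)
    (y : 'I_n -> S) (co : {linear S -> {mpoly k[n]}})
    (mon : {linear {mpoly k[n]} -> S}) : Prop := Pbw {
  pbw_coK : cancel co mon;
  pbw_co1 : co 1 = 1;
  pbw_monK : cancel mon co;
  pbw_gr : forall d a, gr d a <-> forall m, mdeg m != d -> (co a)@_m = 0;
  pbw_yC : forall i a, y i * a = a * y i;
  pbw_coy : forall i a, co (y i * a) = co a * 'X_[U_(i) *+ 2];
  pbw_graded : connected_graded gr }.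

Section Coordinates.
Variables (k : fieldType) (S : algType k) (gr : nat -> S -> Prop) (n : nat).
Variables (y : 'I_n -> S) (co : {linear S -> {mpoly k[n]}}).
Variable (mon : {linear {mpoly k[n]} -> S}).
Hypothesis H : pbw gr y co mon.

Lemma co_inj a b : (forall m, (co a)@_m = (co b)@_m) -> a = b.
Proof. by move=> e; apply: (can_inj (pbw_coK H)); apply/mpolyP. Qed.

Lemma grzP j a :
  grz gr j a <-> forall m : 'X_{1..n}, (mdeg m)%:Z != j -> (co a)@_m = 0.
Proof.
case: j => d /=; first exact: (pbw_gr H).
split=> [-> m _|a0]; first by rewrite linear0 mcoeff0.
by apply: co_inj => m; rewrite linear0 mcoeff0 a0.
Qed.

Lemma grz_comb j c a b : grz gr j a -> grz gr j b -> grz gr j (c *: a + b).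
Proof.
move=> /grzP ja /grzP jb; apply/grzP => m mj.
by rewrite linearP mcoeffD mcoeffZ ja // jb // mulr0 addr0.
Qed.

Lemma grz0 j : grz gr j 0.
Proof. by apply/grzP => m _; rewrite linear0 mcoeff0. Qed.

Lemma grz_mulr j d a b : grz gr j a -> gr d b -> grz gr (j + d%:Z) (a * b).
Proof.
case: j => e /= ja db; first exact: (gr_mul (pbw_graded H)).
by rewrite ja mul0r; apply: grz0.
Qed.

Lemma grz_mull j d a b : gr d b -> grz gr j a -> grz gr (j + d%:Z) (b * a).
Proof.
case: j => e /= db ja; last by rewrite ja mulr0; apply: grz0.
by rewrite addnC; apply: (gr_mul (pbw_graded H)).
Qed.

(** The coefficient at m becomes h m times the one at t m. Cutting the sum at the size of [co a]
    keeps it finite and loses nothing as long as t does not lower degrees. Homogeneous components,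
    division by y_i and the squarefree part all have this form. *)
Definition coord_op (t : 'X_{1..n} -> 'X_{1..n}) (h : 'X_{1..n} -> k) (a : S) : S :=
  mon (\sum_(m : 'X_{1..n < msize (co a)}) (h m * (co a)@_(t m)) *: 'X_[m]).

Lemma co_coord_op t h a m : (mdeg m <= mdeg (t m))%N ->
  (co (coord_op t h a))@_m = h m * (co a)@_(t m).
Proof.
move=> tm; rewrite /coord_op (pbw_monK H).
have [ma|am] := ltnP (mdeg m) (msize (co a)).
  by rewrite (mcoeff_mpoly (fun m => h m * (co a)@_(t m))).
rewrite (memN_msupp_eq0 (m := t m)) ?mulr0; last first.
  by apply: msize_mdeg_ge; apply: leq_trans tm.
rewrite raddf_sum /= big1 // => i _.
rewrite mcoeffZ mcoeffX; case: eqP => [e|_]; last by rewrite mulr0.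
by have := bmdeg i; rewrite e ltnNge am.
Qed.

Lemma coord_op_comb t h c a b : (forall m, mdeg m <= mdeg (t m))%N ->
  coord_op t h (c *: a + b) = c *: coord_op t h a + coord_op t h b.
Proof.
move=> tm; apply: co_inj => m.
rewrite linearP mcoeffD mcoeffZ !co_coord_op // linearP mcoeffD mcoeffZ.
by rewrite mulrDr mulrCA.
Qed.

Definition component (d : nat) : S -> S := coord_op id (fun m => (mdeg m == d)%:R).

Lemma co_component d a m : (co (component d a))@_m = (mdeg m == d)%:R * (co a)@_m.
Proof. exact: co_coord_op. Qed.

Lemma component_gr d a : gr d (component d a).
Proof.
by apply/(pbw_gr H) => m /negPf md; rewrite co_component md mul0r.
Qed.

Lemma tailP i a :
  tail gr i a <-> forall m : 'X_{1..n}, (mdeg m < i)%N -> (co a)@_m = 0.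
Proof.
split=> [[N [s [gs ->]]] m mi|a0].
  rewrite linear_sum raddf_sum /= big_nat big1 // => d /andP[id _].
  by move/(pbw_gr H): (gs d) => -> //; rewrite neq_ltn (leq_trans mi id).
exists (msize (co a)), (component^~ a); split=> [d|].
  exact: component_gr.
apply: co_inj => m; rewrite linear_sum raddf_sum /=.
under eq_bigr do rewrite co_component.
have [mi|im] := ltnP (mdeg m) i.
  rewrite a0 // big_nat big1 // => d /andP[id _].
  by rewrite mulr0.
have [ma|am] := ltnP (mdeg m) (msize (co a)).
  rewrite (bigD1_seq (mdeg m)) ?mem_index_iota ?im ?iota_uniq //= eqxx mul1r.
  by rewrite big1 ?addr0 // => d; rewrite eq_sym => /negPf ->; rewrite mul0r.
rewrite (memN_msupp_eq0 (msize_mdeg_ge am)) big1 // => d _.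
by rewrite mulr0.
Qed.

Lemma tail_gr i d a : (i <= d)%N -> gr d a -> tail gr i a.
Proof.
move=> id /(pbw_gr H) ga; apply/tailP => m mi; apply: ga.
by rewrite neq_ltn (leq_trans mi id).
Qed.

Lemma tail_le i i' a : (i <= i')%N -> tail gr i' a -> tail gr i a.
Proof. by move=> le /tailP ta; apply/tailP => m mi; apply: ta (leq_trans mi le). Qed.

Lemma tail_comb i c a b : tail gr i a -> tail gr i b -> tail gr i (c *: a + b).
Proof.
move=> /tailP ta /tailP tb; apply/tailP => m mi.
by rewrite linearP mcoeffD mcoeffZ ta // tb // mulr0 addr0.
Qed.

Lemma tail_nil i : tail gr i 0.
Proof. by apply/tailP => m _; rewrite linear0 mcoeff0. Qed.

Lemma tail_sum i (I : Type) (r : seq I) (P : pred I) (F : I -> S) :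
  (forall t, P t -> tail gr i (F t)) -> tail gr i (\sum_(t <- r | P t) F t).
Proof.
move=> tF; apply: (big_ind (tail gr i)) => //; first exact: tail_nil.
by move=> a b ta tb; rewrite -[a]scale1r; apply: tail_comb.
Qed.

Lemma gr_split a : exists N, a = \sum_(d < N) component d a.
Proof.
exists (msize (co a)); apply: co_inj => m; rewrite linear_sum raddf_sum /=.
under eq_bigr do rewrite co_component.
have [ma|am] := ltnP (mdeg m) (msize (co a)).
  rewrite (bigD1 (Ordinal ma)) //= eqxx mul1r big1 ?addr0 // => d.
  by rewrite -val_eqE /= eq_sym => /negPf ->; rewrite mul0r.
by rewrite (memN_msupp_eq0 (msize_mdeg_ge am)) big1 // => d _; rewrite mulr0.
Qed.

Lemma tail_mul i i' a b : tail gr i a -> tail gr i' b -> tail gr (i + i') (a * b).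
Proof.
move=> /tailP ta /tailP tb.
have [N ->] := gr_split a; have [N' ->] := gr_split b.
rewrite mulr_suml; apply: tail_sum => d _; rewrite mulr_sumr; apply: tail_sum => e _.
have [di|id] := ltnP d i.
  rewrite [component d a](_ : _ = 0) ?mul0r; first exact: tail_nil.
  apply: co_inj => m; rewrite co_component linear0 mcoeff0.
  by case: eqP => [md|_]; rewrite ?mul0r // ta ?mulr0 // md.
have [ei|ie] := ltnP e i'.
  rewrite [component e b](_ : _ = 0) ?mulr0; first exact: tail_nil.
  apply: co_inj => m; rewrite co_component linear0 mcoeff0.
  by case: eqP => [me|_]; rewrite ?mul0r // tb ?mulr0 // me.
apply: (@tail_gr _ (d + e)); first by rewrite leq_add.
by apply: (gr_mul (pbw_graded H)); apply: component_gr.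
Qed.

Lemma tail0 a : tail gr 0 a.
Proof. exact/tailP. Qed.

Lemma tail_mulr i a b : tail gr i a -> tail gr i (a * b).
Proof. by move=> ta; rewrite -[i]addn0; apply: tail_mul => //; apply: tail0. Qed.

End Coordinates.

(** * Bar cochains *)

Section Cochains.
Variables (k : fieldType) (S : algType k) (gr : nat -> S -> Prop) (n : nat).
Variables (y : 'I_n -> S) (co : {linear S -> {mpoly k[n]}}).
Variable (mon : {linear {mpoly k[n]} -> S}).
Hypothesis H : pbw gr y co mon.

Local Notation cochains N := (ext_cochain gr (tail gr N)).

Lemma multilinear_bar_diff p (f : cochain S) :
  (forall (c : k) u v s1 s2, (size s1 + size s2)%N = p ->
     f (s1 ++ (c *: u + v) :: s2) = c *: f (s1 ++ u :: s2) + f (s1 ++ v :: s2)) ->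
  forall (c : k) u v s1 s2, (size s1 + size s2)%N = p.+1 ->
    bar_diff p f (s1 ++ (c *: u + v) :: s2) =
      c *: bar_diff p f (s1 ++ u :: s2) + bar_diff p f (s1 ++ v :: s2).
Proof.
have subD (c : k) (a1 a2 b1 b2 : S) :
    c *: a1 + a2 - (c *: b1 + b2) = c *: (a1 - b1) + (a2 - b2).
  by rewrite opprD addrACA scalerBr.
elim: p f => [|p IHp] f flin c u v [|m s1] s2 /=.
- case: s2 => [|a []] // _; rewrite !bar_diff0E /= ?take0 mulrDl -scalerAl.
  have /= -> := flin c (u * a) (v * a) [::] [::] erefl.
  have /= -> := flin c u v [::] [::] erefl.
  by rewrite mulrDl -scalerAl subD.
- case=> /eqP; rewrite addn_eq0 => /andP[/nilP-> /nilP->]; rewrite !bar_diff0E /= mulrDr -scalerAr.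
  have /= -> := flin c (m * u) (m * v) [::] [::] erefl.
  by rewrite mulrDr -scalerAr subD.
- case: s2 => [|a s2] // [s2p]; rewrite !bar_diffS /= mulrDl -scalerAl.
  have /= -> := flin c (u * a) (v * a) [::] s2 _; last exact: s2p.
  rewrite (@eq_bar_diff _ _ _ _ (fun s => c *: f (u :: s) + f (v :: s))) /= ?s2p //.
    by rewrite bar_diff_comb subD.
  by move=> s [ss]; have /= -> := flin c u v [::] s ss.
move=> [s12]; rewrite !bar_diffS.
rewrite (IHp (fun s => f (m :: s))) // => [|c' u' v' s1' s2' s12'].
  case: s1 s12 => [|a s1] /= s12.
    have /= := flin c (m * u) (m * v) [::] s2 s12.
    by rewrite mulrDr -scalerAr => ->; rewrite subD.
  have /= -> := flin c u v (m * a :: s1) s2 _; last by rewrite /= -s12.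
  by rewrite subD.
by have /= -> := flin c' u' v' (m :: s1') s2' _; rewrite //= addSn s12'.
Qed.

Lemma homogeneous_bar_diff p j (f : cochain S) :
  (forall (s : seq S) (e : seq nat), size s = p.+1 -> size e = p.+1 ->
     (forall t, (t < p.+1)%N -> gr (nth 0%N e t) s`_t) ->
     grz gr (j + (sumn e)%:Z) (f s)) ->
  forall (s : seq S) (e : seq nat), size s = p.+2 -> size e = p.+2 ->
    (forall t, (t < p.+2)%N -> gr (nth 0%N e t) s`_t) ->
    grz gr (j + (sumn e)%:Z) (bar_diff p f s).
Proof.
have grzB i a b : grz gr i a -> grz gr i b -> grz gr i (a - b).
  by move=> ia ib; rewrite addrC -scaleN1r; apply: (grz_comb H).
elim: p j f => [|p IHp] j f fdeg [|m [|a s]] // [|d [|e es]] // [ss] [se] sgr.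
  case: s es ss se sgr => // - [] // _ _ sgr; rewrite bar_diff0E /= addn0.
  have gm := sgr 0 isT; have ga := sgr 1 isT.
  apply: (grzB).
    have := fdeg [:: m * a] [:: (d + e)%N] erefl erefl; rewrite /= addn0; apply.
    by move=> [|//] _; apply: (gr_mul (pbw_graded H)).
  rewrite PoszD addrA; apply: (grz_mulr H) => //.
  have := fdeg [:: m] [:: d] erefl erefl; rewrite /= addn0; apply.
  by move=> [|].
rewrite bar_diffS /=; apply: (grzB).
  have := fdeg (m * a :: s) ((d + e)%N :: es); rewrite /= ss se addnA; apply => //.
  move=> [_|t tp]; last exact: (sgr t.+2).
  by apply: (gr_mul (pbw_graded H)); [exact: (sgr 0)|exact: (sgr 1)].
rewrite PoszD addrA; apply: (IHp (j + d%:Z) _ _ (a :: s) (e :: es)) => //=.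
- move=> s' e' ss' se' gse; rewrite -addrA -PoszD.
  apply: (fdeg (m :: s') (d :: e')); rewrite /= ?ss' ?se' //.
  move=> [_|t tp]; [exact: (sgr 0)|exact: gse].
- by rewrite ss.
- by rewrite se.
- by move=> t tp; apply: (sgr t.+1).
Qed.

Lemma cochain_bar_diff N p j f :
  cochains N p j f -> cochains N p.+1 j (bar_diff p f).
Proof.
move=> [flin fI fdeg]; split; [exact: multilinear_bar_diff| |].
  move=> m [|a s] // [sp] tm; case: p flin fI fdeg sp => [|p] flin fI fdeg sp.
    case: s sp => // _; rewrite bar_diff0E /= !(fI _ [::]) // ?mul0r ?subrr //.
    exact: (tail_mulr H).
  rewrite bar_diffS /= fI //; last exact: (tail_mulr H).
  rewrite (@eq_bar_diff _ _ _ _ (fun=> 0)) /= ?sp //; last first.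
    by move=> s' ss'; apply: fI.
  rewrite /bar_diff mul0r mulr0 addr0 big1 ?subrr // => i _.
  by rewrite mulr0.
exact: homogeneous_bar_diff.
Qed.

Lemma cochain_comb N p j c f g : cochains N p j f -> cochains N p j g ->
  cochains N p j (fun s => c *: f s + g s).
Proof.
move=> [flin fI fdeg] [glin gI gdeg]; split=> [c' u v s1 s2 s12|m s sp tm|s e ss se gse].
- rewrite flin // glin // !scalerDr addrACA; congr (_ + _).
  by rewrite !scalerA mulrC.
- by rewrite fI // gI // scaler0 addr0.
by apply: (grz_comb H); [exact: fdeg|exact: gdeg].
Qed.

Lemma cochain0 N p j : cochains N p j (fun=> 0).
Proof.
split=> [c u v s1 s2 _|//|s e _ _ _]; first by rewrite scaler0 addr0.
exact: (grz0 H).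
Qed.

Lemma cochain_le N N' p j f : (N <= N')%N -> cochains N p j f -> cochains N' p j f.
Proof. by move=> le [flin fI fdeg]; split=> // m s sp /(tail_le H le); apply: fI. Qed.

Lemma eq_cochain N p j f g : (forall s, size s = p.+1 -> f s = g s) ->
  cochains N p j f -> cochains N p j g.
Proof.
move=> efg [flin fI fdeg]; split=> [c u v s1 s2 s12|m s sp tm|s e ss se gse].
- by rewrite -!efg ?flin // size_cat /= addnS s12.
- by rewrite -efg ?fI //= sp.
- by rewrite -efg //; apply: fdeg.
Qed.

Lemma cochainB N p j f g : cochains N p j f -> cochains N p j g ->
  cochains N p j (fun s => f s - g s).
Proof.
move=> fC gC; apply: eq_cochain (cochain_comb (-1) gC fC) => s _.
by rewrite scaleN1r addrC.
Qed.

(** Left multiplication by b carries S_{>= N'} into S_{>= N' + d}. For N = d + 1 and N' = 1 this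
    views the restriction of f to the top layer S_d as cochains on k. *)
Lemma cochain_ract N N' d p j f b : (N <= N' + d)%N -> gr d b ->
  cochains N p j f -> cochains N' p (j + d%:Z) (colim_ract f b).
Proof.
move=> le db [flin fI fdeg]; split=> [c u v [|a s1] s2 s12|m s sp tm|s e ss se gse].
- by rewrite /colim_ract /= mulrDr -scalerAr; apply: (flin c _ _ [::]).
- by apply: (flin c _ _ (b * a :: s1)).
- apply: fI => //; apply: (tail_le H le).
  by rewrite addnC; apply: (tail_mul H) => //; apply: (tail_gr H) db.
case: s e ss se gse => [|m s] // [|d' e] // ss se gse.
rewrite -addrA -PoszD /= addnA; apply: (fdeg (b * m :: s) ((d + d')%N :: e)) => //.
move=> [_|t tp]; last exact: (gse t.+1).
by apply: (gr_mul (pbw_graded H)) => //; apply: (gse 0).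
Qed.

Lemma cochain_comp (L : S -> S) i N p j f :
  (forall c a b, L (c *: a + b) = c *: L a + L b) ->
  (forall j a, grz gr j a -> grz gr (j + i) (L a)) ->
  cochains N p j f -> cochains N p (j + i) (fun s => L (f s)).
Proof.
move=> Llin Ldeg [flin fI fdeg]; split=> [c u v s1 s2 s12|m s sp tm|s e ss se gse].
- by rewrite flin.
- by rewrite fI //; have := Llin (-1) 0 0; rewrite scaler0 addr0 scaleN1r addNr.
- by rewrite addrAC; apply: Ldeg; apply: fdeg.
Qed.

Lemma cochain_lact N d p j f b : gr d b ->
  cochains N p j f -> cochains N p (j + d%:Z) (colim_lact b f).
Proof.
move=> db; apply: cochain_comp => [c u v|i a ia]; last exact: (grz_mull H).
by rewrite mulrDr scalerAr.
Qed.

Lemma cochain_0 N p j f s : cochains N p j f -> size s = p ->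
  forall s1 s2, s = s1 ++ s2 -> f (s1 ++ 0 :: s2) = 0.
Proof.
move=> [flin _ _] sp s1 s2 es; have := flin (-1) 0 0 s1 s2.
by rewrite scaler0 addr0 scaleN1r addNr; apply; rewrite -size_cat -es.
Qed.

Lemma cochain_sum N p j f (I : Type) (r : seq I) (P : pred I) (c : I -> k) (F : I -> S) s :
  cochains N p j f -> size s = p ->
  f ((\sum_(t <- r | P t) c t *: F t) :: s) = \sum_(t <- r | P t) c t *: f (F t :: s).
Proof.
move=> fC sp; have [flin _ _] := fC.
have f0 : f (0 :: s) = 0 by apply: (@cochain_0 _ _ _ _ s fC sp [::]).
elim/big_rec2: _ => [//|t a b _ <-].
by have /= -> := flin (c t) (F t) b [::] s sp.
Qed.

End Cochains.

(** * Coboundaries and the filtration by degree *)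

Section Coboundaries.
Variables (k : fieldType) (S : algType k) (gr : nat -> S -> Prop) (n : nat).
Variables (y : 'I_n -> S) (co : {linear S -> {mpoly k[n]}}).
Variable (mon : {linear {mpoly k[n]} -> S}).
Hypothesis H : pbw gr y co mon.

Local Notation cochains N := (ext_cochain gr (tail gr N)).
Local Notation cocycles N := (ext_cocycle gr (tail gr N)).
Local Notation coboundaries N := (ext_coboundary gr (tail gr N)).

Lemma bar_diff_eq0 p (f : cochain S) l :
  (forall s, size s = p.+1 -> f s = 0) -> size l = p.+2 -> bar_diff p f l = 0.
Proof.
move=> f0 sl; rewrite (@eq_bar_diff _ _ _ _ (fun=> 0)) // /bar_diff.
by rewrite mul0r mulr0 addr0 big1 // => i _; rewrite mulr0.
Qed.

Lemma coboundary_cocycle N p j f : coboundaries N p j f -> cocycles N p j f.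
Proof.
case: p => [f0|p [g gC fg]].
  split; last by move=> s; apply: bar_diff_eq0.
  by apply: eq_cochain (cochain0 H N 0 j) => s /f0.
split; first by apply: eq_cochain (cochain_bar_diff H gC) => s /fg.
by move=> s ss; rewrite (eq_bar_diff fg) // bar_diff_sq.
Qed.

Lemma eq_coboundary N p j f g : (forall s, size s = p.+1 -> f s = g s) ->
  coboundaries N p j f -> coboundaries N p j g.
Proof.
case: p => [efg f0 s s1|p efg [h hC fh]]; first by rewrite -efg ?f0 //.
by exists h => // s ss; rewrite -efg // fh.
Qed.

Lemma coboundary0 N p j : coboundaries N p j (fun=> 0).
Proof.
case: p => [//|p]; exists (fun=> 0) => [|s ss]; first exact: (cochain0 H).
by rewrite bar_diff_eq0.
Qed.

Lemma coboundary_comb N p j c f g : coboundaries N p j f -> coboundaries N p j g ->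
  coboundaries N p j (fun s => c *: f s + g s).
Proof.
case: p => [f0 g0 s s1|p [h hC fh] [h' hC' gh']].
  by rewrite f0 // g0 // scaler0 addr0.
exists (fun s => c *: h s + h' s); first exact: (cochain_comb H).
by move=> s ss; rewrite bar_diff_comb fh // gh'.
Qed.

Lemma coboundaryD N p j f g : coboundaries N p j f -> coboundaries N p j g ->
  coboundaries N p j (fun s => f s + g s).
Proof.
move=> fB gB; apply: eq_coboundary (coboundary_comb 1 fB gB) => s _.
by rewrite scale1r.
Qed.

Lemma coboundary_le N N' p j f : (N <= N')%N ->
  coboundaries N p j f -> coboundaries N' p j f.
Proof.
by case: p => [//|p] le [g gC fg]; exists g => //; apply: (cochain_le H le) gC.
Qed.

Lemma coboundary_ract N N' d p j f b : (N <= N' + d)%N -> gr d b ->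
  coboundaries N p j f -> coboundaries N' p (j + d%:Z) (colim_ract f b).
Proof.
case: p => [|p] le db; first by move=> f0 [|m []] // _; apply: f0.
case=> g gC fg; exists (colim_ract g b); first exact: (cochain_ract H le).
by case=> [|m s] // ss; rewrite bar_diff_ract -fg.
Qed.

Lemma coboundary_lact N d p j f b : gr d b ->
  coboundaries N p j f -> coboundaries N p (j + d%:Z) (colim_lact b f).
Proof.
case: p => [|p] db; first by move=> f0 s s1; rewrite /colim_lact f0 // mulr0.
case=> g gC fg; exists (colim_lact b g); first exact: (cochain_lact H).
by move=> s ss; rewrite /colim_lact bar_diff_lact fg.
Qed.

Lemma cocycle_comb N p j c f g : cocycles N p j f -> cocycles N p j g ->
  cocycles N p j (fun s => c *: f s + g s).
Proof.
move=> [fC f0] [gC g0]; split; first exact: (cochain_comb H).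
by move=> s ss; rewrite bar_diff_comb f0 // g0 // scaler0 addr0.
Qed.

Lemma eq_cocycle N p j f g : (forall s, size s = p.+1 -> f s = g s) ->
  cocycles N p j f -> cocycles N p j g.
Proof.
move=> efg [fC f0]; split; first exact: eq_cochain fC.
by move=> s ss; rewrite -(eq_bar_diff efg) ?f0.
Qed.

Lemma cocycleB N p j f g : cocycles N p j f -> cocycles N p j g ->
  cocycles N p j (fun s => f s - g s).
Proof.
move=> fB gB; apply: eq_cocycle (cocycle_comb (-1) gB fB) => s _.
by rewrite scaleN1r addrC.
Qed.

Lemma cocycle_le N N' p j f : (N <= N')%N -> cocycles N p j f -> cocycles N' p j f.
Proof. by move=> le [fC f0]; split => //; apply: (cochain_le H le) fC. Qed.

Lemma cocycle_ract N N' d p j f b : (N <= N' + d)%N -> gr d b ->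
  cocycles N p j f -> cocycles N' p (j + d%:Z) (colim_ract f b).
Proof.
move=> le db [fC f0]; split; first exact: (cochain_ract H le).
by case=> [|m s] // ss; rewrite bar_diff_ract f0.
Qed.

Lemma cocycle_lact N d p j f b : gr d b ->
  cocycles N p j f -> cocycles N p (j + d%:Z) (colim_lact b f).
Proof.
move=> db [fC f0]; split; first exact: (cochain_lact H).
by move=> s ss; rewrite bar_diff_lact f0 // mulr0.
Qed.

(** * The layers of the filtration S_{>= N} *)

Lemma monX_gr m : gr (mdeg m) (mon 'X_[m]).
Proof.
apply/(pbw_gr H) => m' mm'; rewrite (pbw_monK H) mcoeffX.
by case: (m =P m') mm' => [->|//]; rewrite eqxx.
Qed.

(** Replacing a by its constant term changes m a by an element of S_{>= N+1} only. *)
Lemma co_mulr_low N (m a : S) (b : 'X_{1..n}) : tail gr N m -> mdeg b = N ->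
  (co (m * a))@_b = (co m)@_b * (co a)@_0%MM.
Proof.
move=> tm bN; set c := (co a)@_0%MM.
have ta : tail gr 1 (a - c *: 1).
  apply/(tailP H) => m'; rewrite ltnS leqn0 mdeg_eq0 => /eqP ->.
  by rewrite linearB linearZ /= mcoeffB mcoeffZ (pbw_co1 H) mcoeff1 eqxx mulr1 subrr.
have := tail_mul H tm ta; rewrite addn1 => /(tailP H)/(_ b).
rewrite bN ltnS leqnn => /(_ isT).
rewrite mulrBr -scalerAr mulr1 linearB linearZ /= mcoeffB mcoeffZ.
by move/eqP; rewrite subr_eq0 => /eqP ->; rewrite mulrC.
Qed.

Lemma tail_decomp N m : tail gr N m ->
  tail gr N.+1 (m - \sum_(b : 'X_{1..n < N.+1} | mdeg b == N) (co m)@_b *: mon 'X_[b]).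
Proof.
move=> /(tailP H) tm; apply/(tailP H) => m'; rewrite ltnS leq_eqVlt => m'N.
rewrite linearB linear_sum mcoeffB raddf_sum /=.
under eq_bigr do rewrite linearZ /= (pbw_monK H) mcoeffZ mcoeffX.
case/orP: m'N => [/eqP m'N|m'N].
  have m'b : (mdeg m' < N.+1)%N by rewrite m'N.
  rewrite (bigD1 (BMultinom m'b)) /= ?m'N // eqxx mulr1 big1 ?addr0 ?subrr // => b.
  by rewrite -val_eqE /= => /andP[_ /negPf ->]; rewrite mulr0.
rewrite tm // big1 ?subrr // => b /eqP bN.
by case: eqP => [e|_]; rewrite ?mulr0 //; move: m'N; rewrite -e bN ltnn.
Qed.

(* Assembles a cochain on S/S_{>= N+1} supported on S_N = S_{>= N}/S_{>= N+1}
   from cochains on k, one for each basis element of S_N. *)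
Definition glue N (h : 'X_{1..n} -> cochain S) : cochain S := fun l =>
  \sum_(b : 'X_{1..n < N.+1} | mdeg b == N) (co (head 0 l))@_b *: h b (1 :: behead l).

Lemma glue_cochain N p j h :
  (forall b, mdeg b = N -> cochains 1 p (j + N%:Z) (h b)) ->
  cochains N.+1 p j (glue N h).
Proof.
move=> hC; split=> [c u v [|a s1] s2 s12|m s sp tm|s e ss se gse]; rewrite /glue /=.
- rewrite scaler_sumr -big_split; apply: eq_bigr => b _ /=.
  by rewrite linearP mcoeffD mcoeffZ scalerDl scalerA.
- rewrite scaler_sumr -big_split; apply: eq_bigr => b /eqP bN /=.
  have [hlin _ _] := hC b bN; have /= -> := hlin c u v (1 :: s1) s2 s12.
  by rewrite scalerDr !scalerA mulrC.
- move/(tailP H) in tm; rewrite big1 // => b /eqP bN.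
  by rewrite tm ?scale0r // bN.
case: s e ss se gse => [|m s] // [|d e] // [ss] [se] gse /=.
apply: (big_ind (grz gr _)) => [||b /eqP bN]; first exact: (grz0 H).
  by move=> u v gu gv; rewrite -[u]scale1r; apply: (grz_comb H).
have gm := gse 0 isT; rewrite /= in gm.
have [dN|dN] := eqVneq d N; last first.
  by move/(pbw_gr H): gm => ->; rewrite ?scale0r ?bN 1?eq_sym //; apply: (grz0 H).
rewrite -[_ *: _]addr0; apply: (grz_comb H); last exact: (grz0 H).
rewrite PoszD addrA dN; have [_ _ hdeg] := hC b bN.
apply: (hdeg (1 :: s) (0%N :: e)); rewrite /= ?ss ?se //.
move=> [_|t tp]; last exact: (gse t.+1).
by apply/(gr_conn (pbw_graded H)); exists 1; rewrite scale1r.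
Qed.

Lemma bar_diff_sum p (I : Type) (r : seq I) (P : pred I) (c : I -> k)
    (F : I -> cochain S) l : size l = p.+2 ->
  bar_diff p (fun s => \sum_(t <- r | P t) c t *: F t s) l =
  \sum_(t <- r | P t) c t *: bar_diff p (F t) l.
Proof.
move=> sl; elim: r => [|t r IHr].
  by rewrite big_nil bar_diff_eq0 // => s _; rewrite big_nil.
rewrite big_cons -IHr; case: ifP => Pt.
  by rewrite -bar_diff_comb; apply: eq_bar_diff => // s _; rewrite big_cons Pt.
by apply: eq_bar_diff => // s _; rewrite big_cons Pt.
Qed.

(** [glue] evaluates h_b at 1 in the first place, yet a reappears there: both sides depend only on
    the constant term of a, the right one because h_b vanishes on S_{>= 1}. *)
Lemma glue_mulr N p j h m a s :
  (forall b, mdeg b = N -> cochains 1 p (j + N%:Z) (h b)) ->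
  tail gr N m -> size s = p ->
  glue N h (m * a :: s) =
  \sum_(b : 'X_{1..n < N.+1} | mdeg b == N) (co m)@_b *: h b (a :: s).
Proof.
move=> hC tm sp.
apply: eq_bigr => b /eqP bN /=; rewrite (co_mulr_low _ tm) // -scalerA; congr (_ *: _).
set c := (co a)@_0%MM.
have ta : tail gr 1 (a - c *: 1).
  apply/(tailP H) => m'; rewrite ltnS leqn0 mdeg_eq0 => /eqP ->.
  by rewrite linearB linearZ /= mcoeffB mcoeffZ (pbw_co1 H) mcoeff1 eqxx mulr1 subrr.
have [hlin hI _] := hC b bN.
have /= := hlin c 1 (a - c *: 1) [::] s sp.
have -> : c *: 1 + (a - c *: 1) = a by rewrite addrCA subrr addr0.
by move=> ->; rewrite (hI _ _ sp ta) addr0.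
Qed.

(** Gluing commutes with the differential only on S_{>= N}. Elsewhere, products that reach S_N from
    lower degrees contribute; they form the connecting map into the next Ext of S/S_{>= N}. *)
Lemma bar_diff_glue N p j h m l :
  (forall b, mdeg b = N -> cochains 1 p (j + N%:Z) (h b)) ->
  tail gr N m -> size l = p.+1 ->
  bar_diff p (glue N h) (m :: l) =
  \sum_(b : 'X_{1..n < N.+1} | mdeg b == N) (co m)@_b *: bar_diff p (h b) (1 :: l).
Proof.
move=> hC tm; case: l => [|a s] // [sp].
have glueM := glue_mulr a hC tm sp.
case: p hC sp => [|p] hC sp.
  case: s sp glueM => // _ glueM; rewrite bar_diff0E /= glueM {1}/glue /= mulr_suml -sumrB.
  apply: eq_bigr => b _.
  by rewrite bar_diff0E /= mul1r scalerBr scalerAl.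
rewrite bar_diffS /= glueM.
rewrite [X in _ - X](@bar_diff_sum _ _ _ _ (fun b : 'X_{1..n < N.+1} => (co m)@_b)
  (fun b s => h b (1 :: s))) /= ?sp // -sumrB.
by apply: eq_bigr => b _; rewrite bar_diffS /= mul1r scalerBr.
Qed.

(* The long exact sequence of  0 -> S_N (x) k(-N) -> S/S_{>= N+1} -> S/S_{>= N} -> 0. *)
Lemma cochain_reduce N p j f : cochains N.+1 p j f ->
  (forall b, mdeg b = N ->
     coboundaries 1 p (j + N%:Z) (colim_ract f (mon 'X_[b]))) ->
  exists2 f', cochains N p j f' & coboundaries N.+1 p j (fun s => f s - f' s).
Proof.
move=> fC fb; have [flin fI fdeg] := fC.
have fdec m s : tail gr N m -> size s = p -> f (m :: s) =
    \sum_(b : 'X_{1..n < N.+1} | mdeg b == N)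
      (co m)@_b *: colim_ract f (mon 'X_[b]) (1 :: s).
  move=> tm sp; have := fI _ s sp (tail_decomp tm); set x := \sum_(b | _) _ => f0.
  have /= := flin 1 x (m - x) [::] s sp.
  rewrite f0 addr0 !scale1r addrCA subrr addr0 => ->.
  rewrite (cochain_sum _ _ _ _ fC sp).
  by apply: eq_bigr => b _; rewrite /colim_ract /= mulr1.
case: p fC fb flin fI fdeg fdec => [|p] fC fb flin fI fdeg fdec.
  exists f; last by move=> s _; rewrite subrr.
  split=> // m s sp tm; rewrite fdec // big1 // => b /eqP bN.
  by rewrite fb //= ?scaler0 //= sp.
have [h hP] : exists h : 'X_{1..n} -> cochain S, forall b, mdeg b = N ->
    cochains 1 p (j + N%:Z) (h b) /\
    forall s, size s = p.+2 -> colim_ract f (mon 'X_[b]) s = bar_diff p (h b) s.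
  apply: (functional_choice (fun b h => mdeg b = N -> cochains 1 p (j + N%:Z) h /\
    forall s, size s = p.+2 -> colim_ract f (mon 'X_[b]) s = bar_diff p h s)) => b.
  have [bN|bN] := eqVneq (mdeg b) N; last by exists (fun=> 0) => /eqP; rewrite (negPf bN).
  by have [g gC fg] := fb b bN; exists g.
have hC b : mdeg b = N -> cochains 1 p (j + N%:Z) (h b) by move=> /hP[].
have gC := cochain_bar_diff H (glue_cochain hC).
(* The two terms agree on S_{>= N}, so their difference lives on S/S_{>= N}. *)
exists (fun s => f s - bar_diff p (glue N h) s); last first.
  exists (glue N h); first exact: glue_cochain.
  by move=> s _; rewrite opprB addrCA subrr addr0.
have [dlin dI ddeg] := cochainB H fC gC; split => // m s sp tm.
rewrite fdec // (bar_diff_glue hC) // -sumrB big1 // => b /eqP bN.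
by have [_ ->] := hP b bN; rewrite /= ?sp // subrr.
Qed.

Lemma cocycle_reduce N p j f : cocycles N.+1 p j f ->
  (forall b, mdeg b = N ->
     coboundaries 1 p (j + N%:Z) (colim_ract f (mon 'X_[b]))) ->
  exists2 f', cocycles N p j f' & coboundaries N.+1 p j (fun s => f s - f' s).
Proof.
move=> fZ fb; have [f' f'C dB] := cochain_reduce (proj1 fZ) fb.
exists f' => //; split => // s ss.
have [_ d0] := cocycleB fZ (coboundary_cocycle dB).
rewrite -(d0 s ss); apply: eq_bar_diff => // s' _.
by rewrite opprB addrCA subrr addr0.
Qed.

Lemma cochain_tail0 p j f s : cochains 0 p j f -> size s = p.+1 -> f s = 0.
Proof.
by case: s => [|m s] // [_ fI _] [sp]; apply: fI => //; apply: (tail0 H).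
Qed.

Lemma coboundary_tail0 p j f : cochains 0 p j f -> coboundaries 0 p j f.
Proof.
move=> fC; apply: eq_coboundary (coboundary0 0 p j) => s ss.
by rewrite (cochain_tail0 fC).
Qed.

End Coboundaries.

(** * The colimit of the top Ext groups *)

Section LocalCohomology.
Variables (k : fieldType) (S : algType k) (gr : nat -> S -> Prop) (n : nat).
Variables (y : 'I_n -> S) (co : {linear S -> {mpoly k[n]}}).
Variable (mon : {linear {mpoly k[n]} -> S}).
Hypothesis H : pbw gr y co mon.
Hypothesis extk : forall p j,
  ext_dim gr (tail gr 1) p j ((p == n) && (j == - n%:Z)).

Local Notation cochains N := (ext_cochain gr (tail gr N)).
Local Notation cocycles N := (ext_cocycle gr (tail gr N)).
Local Notation coboundaries N := (ext_coboundary gr (tail gr N)).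
Local Notation null := (colim_coboundary gr n).

Lemma ext_k_vanish p j f : ~~ ((p == n) && (j == - n%:Z)) ->
  cocycles 1 p j f -> coboundaries 1 p j f.
Proof.
move=> /negPf pj fZ; have := extk p j; rewrite pj => -[z [_ zP]].
have [c [fB _]] := zP f fZ; apply: eq_coboundary fB => s _.
by rewrite big_ord0 subr0.
Qed.

(** Induction on N: each layer contributes copies of Ext^p(k, S) = 0, so a cocycle can be pushed
    down to level 0, where all cochains vanish. *)
Lemma ext_vanish N p j f : p != n -> cocycles N p j f -> coboundaries N p j f.
Proof.
move=> pn; elim: N f => [|N IHN] f fZ; first by apply: (coboundary_tail0 H); case: fZ.
have [b bN|f' f'Z dB] := cocycle_reduce H fZ.
  apply: ext_k_vanish; first by rewrite (negPf pn).
  by rewrite -bN; apply: (cocycle_ract H _ _ fZ); [rewrite bN add1n|exact: (monX_gr H)].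
have f'B := coboundary_le H (leqnSn N) (IHN f' f'Z).
by apply: eq_coboundary (coboundaryD H dB f'B) => s _; rewrite subrK.
Qed.

(** Injectivity of the transition map from level N to level N + 1: its kernel comes from Ext^(p-1)
    of the layer S_N, which is zero as p - 1 < n. *)
Lemma coboundary_descend N p j f : (p <= n)%N ->
  coboundaries N.+1 p j f -> cochains N p j f -> coboundaries N p j f.
Proof.
case: p => [//|q] qn [g gC fg] fC.
have [b bN|g' g'C dB] := cochain_reduce H gC.
  apply: ext_k_vanish; first by rewrite (ltn_eqF qn).
  split; first by rewrite -bN; apply: (cochain_ract H _ _ gC);
    [rewrite bN add1n|exact: (monX_gr H)].
  (* g itself is no cocycle, but its restriction to S_N is, since dg = f vanishes on S_{>= N}. *)
  move=> [|m s] // [ss]; rewrite bar_diff_ract -fg /= ?ss //.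
  have [_ fI _] := fC; apply: fI => //.
  by apply: (tail_mulr H); apply: (tail_gr H) (monX_gr H b); rewrite bN.
exists g' => // s ss; rewrite fg //.
have [_ d0] := coboundary_cocycle H dB.
apply/eqP; rewrite -subr_eq0 -(d0 s ss); apply/eqP; rewrite [RHS](@eq_bar_diff _ _ _ _
  (fun s => -1 *: g' s + g s)) //.
  by rewrite bar_diff_comb scaleN1r addrC.
by move=> s' _; rewrite scaleN1r addrC.
Qed.

Lemma null_coboundary N j f : null j f -> cochains N n j f -> coboundaries N n j f.
Proof.
case=> N'; elim: N' => [|N' IHN'] fB fC; first exact: (coboundary_le H (leq0n N)).
have [le|lt] := leqP N'.+1 N; first exact: (coboundary_le H le).
apply: IHN' => //; apply: coboundary_descend => //.
by apply: (cochain_le H _ fC).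
Qed.

Lemma eq_null j f g : (forall s, size s = n.+1 -> f s = g s) -> null j f -> null j g.
Proof. by move=> efg [N fB]; exists N; apply: eq_coboundary fB. Qed.

Lemma null_comb j c f g : null j f -> null j g -> null j (fun s => c *: f s + g s).
Proof.
move=> [N fB] [N' gB]; exists (maxn N N').
by apply: (coboundary_comb H); [apply: (coboundary_le H _ fB)|
  apply: (coboundary_le H _ gB)]; rewrite ?leq_maxl ?leq_maxr.
Qed.

Lemma null0 j : null j (fun=> 0).
Proof. by exists 0%N; apply: (coboundary0 H). Qed.

Lemma nullB j f g : null j f -> null j g -> null j (fun s => f s - g s).
Proof.
move=> f0 g0; apply: eq_null (null_comb (-1) g0 f0) => s _.
by rewrite scaleN1r addrC.
Qed.

Lemma nullD j f g : null j f -> null j g -> null j (fun s => f s + g s).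
Proof.
move=> f0 g0; apply: eq_null (null_comb 1 f0 g0) => s _.
by rewrite scale1r.
Qed.

Lemma nullZ j c f : null j f -> null j (fun s => c *: f s).
Proof.
by move=> f0; apply: eq_null (null_comb c f0 (null0 j)) => s _; rewrite addr0.
Qed.

Lemma null_ract d j b f : gr d b -> null j f -> null (j + d%:Z) (colim_ract f b).
Proof.
move=> db [N fB]; exists N; apply: (coboundary_ract H _ db fB).
exact: leq_addr.
Qed.

Lemma null_lact d j b f : gr d b -> null j f -> null (j + d%:Z) (colim_lact b f).
Proof. by move=> db [N fB]; exists N; apply: (coboundary_lact H db fB). Qed.

Lemma colim_cocycle_comb j c f g :
  colim_cocycle gr n j f -> colim_cocycle gr n j g ->
  colim_cocycle gr n j (fun s => c *: f s + g s).
Proof.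
move=> [N fZ] [N' gZ]; exists (maxn N N').
by apply: (cocycle_comb H); [apply: (cocycle_le H _ fZ)|
  apply: (cocycle_le H _ gZ)]; rewrite ?leq_maxl ?leq_maxr.
Qed.

Lemma colim_cocycle_ract d j b f : gr d b -> colim_cocycle gr n j f ->
  colim_cocycle gr n (j + d%:Z) (colim_ract f b).
Proof.
move=> db [N fZ]; exists N; apply: (cocycle_ract H _ db fZ).
exact: leq_addr.
Qed.

Lemma colim_cocycle_lact d j b f : gr d b -> colim_cocycle gr n j f ->
  colim_cocycle gr n (j + d%:Z) (colim_lact b f).
Proof. by move=> db [N fZ]; exists N; apply: (cocycle_lact H db fZ). Qed.

Lemma colim_cocycleB j f g : colim_cocycle gr n j f -> colim_cocycle gr n j g ->
  colim_cocycle gr n j (fun s => f s - g s).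
Proof.
move=> fZ gZ; have [N hZ] := colim_cocycle_comb (-1) gZ fZ; exists N.
by apply: eq_cocycle hZ => s _; rewrite scaleN1r addrC.
Qed.

(** Nondegeneracy of the pairing on the side of D. The layer S_N sees f through Ext^n(k, S) in
    degree j + N, which is zero unless j + N = -n; the hypothesis handles that one layer. *)
Lemma null_by_socle j f : colim_cocycle gr n j f ->
  (forall b : 'X_{1..n}, j + (mdeg b)%:Z = - n%:Z ->
     null (j + (mdeg b)%:Z) (colim_ract f (mon 'X_[b]))) ->
  null j f.
Proof.
case=> N; elim: N f => [|N IHN] f fZ fb.
  by exists 0%N; apply: (coboundary_tail0 H); case: fZ.
have [b bN|f' f'Z dB] := cocycle_reduce H fZ.
  have fbZ : cocycles 1 n (j + N%:Z) (colim_ract f (mon 'X_[b])).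
    by rewrite -bN; apply: (cocycle_ract H _ _ fZ); [rewrite bN add1n|exact: (monX_gr H)].
  have [jN|jN] := eqVneq (j + N%:Z) (- n%:Z); last first.
    by apply: ext_k_vanish => //; rewrite (negPf jN) andbF.
  apply: null_coboundary; last by case: fbZ.
  by move: jN; rewrite -bN; apply: fb.
have d0 : null j (fun s => f s - f' s) by exists N.+1.
have f'0 : null j f'.
  apply: IHN => // b jb.
  apply: eq_null (nullB (fb b jb) (null_ract (monX_gr H b) d0)) => s _.
  by rewrite /colim_ract opprB addrCA subrr addr0.
by apply: eq_null (nullD d0 f'0) => s _; rewrite subrK.
Qed.

(** In degree -n every class comes from S/S_{>= 1} = k: a layer S_N with N > 0 sees f in degree -n +
    N, where Ext^n(k, S) is zero. *)
Lemma socle_reduce j f : colim_cocycle gr n j f -> j = - n%:Z ->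
  exists2 f', cocycles 1 n j f' & null j (fun s => f s - f' s).
Proof.
case=> N; elim: N f => [|N IHN] f fZ jn.
  by exists f; [exact: (cocycle_le H _ fZ)|apply: eq_null (null0 j) => s _; rewrite subrr].
case: N IHN fZ => [|N] IHN fZ.
  by exists f => //; apply: eq_null (null0 j) => s _; rewrite subrr.
have [b bN|f1 f1Z dB] := cocycle_reduce H fZ.
  apply: ext_k_vanish; first by rewrite eqxx jn; lia.
  by rewrite -bN; apply: (cocycle_ract H _ _ fZ); [rewrite bN add1n|exact: (monX_gr H)].
have [f' f'Z d'0] := IHN f1 f1Z jn; exists f' => //.
have d0 : null j (fun s => f s - f1 s) by exists N.+2.
by apply: eq_null (nullD d0 d'0) => s _; rewrite addrA subrK.
Qed.

(** [res] is picked separately for each cocycle; its linearity is recovered later from the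
    uniqueness of the coefficient. Uniqueness holds because a null multiple of z is already a
    coboundary at level 1, where Ext^n(k, S) is known. *)
Lemma socle_residue : exists (z : cochain S) (res : cochain S -> k),
  [/\ cocycles 1 n (- n%:Z) z,
      forall f, colim_cocycle gr n (- n%:Z) f ->
        null (- n%:Z) (fun s => f s - res f *: z s)
    & forall c : k, null (- n%:Z) (fun s => c *: z s) -> c = 0].
Proof.
have := extk n (- n%:Z); rewrite !eqxx /= => -[z [zZ zP]].
have zcoord f : colim_cocycle gr n (- n%:Z) f ->
    exists c : k, null (- n%:Z) (fun s => f s - c *: z 0 s).
  move=> fZ; have [f' f'Z d0] := socle_reduce fZ erefl.
  have [c [f'B _]] := zP f' f'Z; exists (c 0).
  have f'0 : null (- n%:Z) (fun s => f' s - \sum_t c t *: z t s) by exists 1%N.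
  apply: eq_null (nullD d0 f'0) => s _.
  by rewrite big_ord1 addrA subrK.
have [res resP] : exists res : cochain S -> k, forall f,
    colim_cocycle gr n (- n%:Z) f -> null (- n%:Z) (fun s => f s - res f *: z 0 s).
  apply: (functional_choice (fun f c => colim_cocycle gr n (- n%:Z) f ->
    null (- n%:Z) (fun s => f s - c *: z 0 s))) => f.
  have [/zcoord[c cP]|nfZ] := classic (colim_cocycle gr n (- n%:Z) f).
    by exists c.
  by exists 0.
exists (z 0), res; split=> // c cz0.
have czZ : cocycles 1 n (- n%:Z) (fun s => c *: z 0 s).
  apply: eq_cocycle (cocycle_comb H c (zZ 0) (coboundary_cocycle H (coboundary0 H 1 n _))).
  by move=> s _; rewrite addr0.
have [u [_ uU]] := zP _ czZ.
have e1 : u = [ffun=> c].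
  apply: uU; apply: eq_coboundary (coboundary0 H 1 n _) => s _.
  by rewrite big_ord1 ffunE subrr.
have e2 : u = [ffun=> 0].
  apply: uU; apply: eq_coboundary (null_coboundary cz0 (proj1 czZ)) => s _.
  by rewrite big_ord1 ffunE scale0r subr0.
by have /ffunP/(_ 0) := etrans (esym e1) e2; rewrite !ffunE.
Qed.

(* The vanishing of Ext^(n+1) corrects the glued cochain to a cocycle. *)
Lemma dual_cocycle z (m : 'X_{1..n}) : cocycles 1 n (- n%:Z) z ->
  exists2 f, colim_cocycle gr n (- n%:Z - (mdeg m)%:Z) f &
    forall b : 'X_{1..n}, mdeg b = mdeg m -> forall s, size s = n.+1 ->
      colim_ract f (mon 'X_[b]) s = (b == m)%:R *: z s.
Proof.
move=> zZ; set N := mdeg m; set j := - n%:Z - N%:Z.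
pose h (b : 'X_{1..n}) : cochain S := fun s => (b == m)%:R *: z s.
have hZ b : mdeg b = N -> cocycles 1 n (j + N%:Z) (h b).
  move=> _; rewrite /j subrK.
  apply: eq_cocycle (cocycle_comb H (b == m)%:R zZ
    (coboundary_cocycle H (coboundary0 H 1 n _))) => s _.
  by rewrite addr0.
have hC b (bN : mdeg b = N) := proj1 (hZ b bN).
have gC := glue_cochain H hC.
have [dlin _ ddeg] := cochain_bar_diff H gC.
(* The pieces h_b are cocycles, so the differential of the glued cochain vanishes on S_{>= N}. It
   therefore lives one level lower, and a correction taken at that level leaves the values on S_N
   untouched. *)
have dC : cochains N n.+1 j (bar_diff n (glue co N h)).
  split=> // a s ss ta; rewrite (bar_diff_glue H hC) // big1 // => b /eqP bN.
  by have [_ ->] := hZ b bN; rewrite ?scaler0 //= ss.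
have dZ : cocycles N n.+1 j (bar_diff n (glue co N h)).
  by split => // s ss; rewrite bar_diff_sq.
have [|h' h'C dh'] := ext_vanish _ dZ; first by rewrite neq_ltn ltnSn orbT.
exists (fun s => glue co N h s - h' s).
  exists N.+1; split; first by apply: (cochainB H gC); apply: (cochain_le H _ h'C).
  move=> s ss; rewrite (@eq_bar_diff _ _ _ _ (fun s => -1 *: h' s + glue co N h s)) //.
    by rewrite bar_diff_comb dh' // scaleN1r addNr.
  by move=> s' _; rewrite scaleN1r addrC.
move=> b bN [|a s] // [ss]; rewrite /colim_ract /=.
have tb : tail gr N (mon 'X_[b]) by apply: (tail_gr H) (monX_gr H b); rewrite bN.
have [_ h'I _] := h'C; rewrite h'I // ?subr0; last exact: (tail_mulr H).
rewrite (glue_mulr H _ hC) // (pbw_monK H).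
have bN1 : (mdeg b < N.+1)%N by rewrite bN.
rewrite (bigD1 (BMultinom bN1)) /= ?bN // mcoeffX eqxx scale1r big1 ?addr0 // => b'.
by rewrite -val_eqE /= => /andP[_ nb]; rewrite mcoeffX eq_sym (negPf nb) scale0r.
Qed.

End LocalCohomology.

(** * The central regular sequence *)

Lemma subrACA (V : zmodType) (a b c d : V) : a - b - (c - d) = a - c - (b - d).
Proof. by rewrite !opprB addrACA [- b - c]addrC addrACA. Qed.

Section CentralRegularSequence.
Variables (k : fieldType) (S : algType k) (gr : nat -> S -> Prop) (n : nat).
Variables (y : 'I_n -> S) (co : {linear S -> {mpoly k[n]}}).
Variable (mon : {linear {mpoly k[n]} -> S}).
Hypothesis H : pbw gr y co mon.
Hypothesis extk : forall p j,
  ext_dim gr (tail gr 1) p j ((p == n) && (j == - n%:Z)).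

Local Notation cochains N := (ext_cochain gr (tail gr N)).
Local Notation cocycles N := (ext_cocycle gr (tail gr N)).
Local Notation coboundaries N := (ext_coboundary gr (tail gr N)).
Local Notation null := (colim_coboundary gr n).

(* The ideal (y_0, ..., y_(r-1)): its elements have no monomial with all m_i < 2, i < r. *)
Definition yideal (r : nat) (a : S) : Prop :=
  forall m : 'X_{1..n}, (forall i : 'I_n, (i < r)%N -> (m i < 2)%N) -> (co a)@_m = 0.

Lemma yideal_comb r c a b : yideal r a -> yideal r b -> yideal r (c *: a + b).
Proof.
by move=> ja jb m mr; rewrite linearP mcoeffD mcoeffZ ja // jb // mulr0 addr0.
Qed.

Lemma yideal0 r : yideal r 0.
Proof. by move=> m _; rewrite linear0 mcoeff0. Qed.

Lemma yidealD r a b : yideal r a -> yideal r b -> yideal r (a + b).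
Proof. by move=> ja jb; rewrite -[a]scale1r; apply: yideal_comb. Qed.

Lemma yidealB r a b : yideal r a -> yideal r b -> yideal r (a - b).
Proof. by move=> ja jb; rewrite addrC -scaleN1r; apply: yideal_comb. Qed.

Lemma yidealN r a : yideal r a -> yideal r (- a).
Proof. by move=> ja; rewrite -sub0r; apply: yidealB ja; apply: yideal0. Qed.

Lemma yideal_eq0 a : yideal 0 a -> a = 0.
Proof.
by move=> ja; apply: (co_inj H) => m; rewrite linear0 mcoeff0 ja.
Qed.

Lemma yideal_le r r' a : (r <= r')%N -> yideal r a -> yideal r' a.
Proof.
by move=> le ja m mr; apply: ja => i ir; apply: mr; apply: leq_trans ir le.
Qed.

Lemma co_y_shift (i : 'I_n) a m : (co (y i * a))@_(m + U_(i) *+ 2) = (co a)@_m.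
Proof. by rewrite (pbw_coy H) addmC mcoeffMX. Qed.

Lemma yideal_y r (i : 'I_n) a : (i < r)%N -> yideal r (y i * a).
Proof.
move=> ir m mr; rewrite (pbw_coy H); apply: memN_msupp_eq0; apply/negP.
rewrite (perm_mem (msuppMX _ _)) => /mapP[m' _ em].
by have := mr i ir; rewrite em mnmDE mulmnE mnm1E eqxx mul1n addnC addn2.
Qed.

Lemma y_gr i : gr 2 (y i).
Proof.
apply/(pbw_gr H) => m m2; rewrite -[y i]mulr1 (pbw_coy H) (pbw_co1 H) mul1r mcoeffX.
by case: (_ =P m) m2 => // <-; rewrite mdegMn mdeg1.
Qed.

(** Regularity of the sequence: y_i shifts only the exponent at i, on which the condition defining
    (y_0, ..., y_(i-1)) does not depend. *)
Lemma yideal_y_inj (i : 'I_n) a : yideal i (y i * a) -> yideal i a.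
Proof.
move=> ja m mr; rewrite -(co_y_shift i); apply: ja => i' ii'.
rewrite mnmDE mulmnE mnm1E -val_eqE /= gtn_eqF // mul0n addn0.
exact: mr.
Qed.

Lemma subm_double (m : 'X_{1..n}) (i : 'I_n) : (1 < m i)%N -> (m - U_(i) *+ 2 + U_(i) *+ 2 = m)%MM.
Proof.
move=> m2; rewrite submK //; apply/mnm_lepP => i'; rewrite mulmnE mnm1E.
by case: eqP => [<-|]; rewrite ?mul1n ?mul0n.
Qed.

Lemma mon_y (m : 'X_{1..n}) (i : 'I_n) : (1 < m i)%N -> mon 'X_[m] = y i * mon 'X_[m - U_(i) *+ 2].
Proof.
move=> m2; apply: (can_inj (pbw_coK H)); rewrite (pbw_coy H) !(pbw_monK H).
by rewrite -mpolyXD subm_double.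
Qed.

(** A monomial with m_i >= 2 for some i < r is y_i times a monomial. This ties the coordinate
    condition to the ideal generated by y_0, ..., y_(r-1). *)
Lemma yideal_ind r (P : S -> Prop) : P 0 ->
  (forall c a b, P a -> P b -> P (c *: a + b)) ->
  (forall (i : 'I_n) a, (i < r)%N -> P (y i * a)) ->
  forall a, yideal r a -> P a.
Proof.
move=> P0 Pcomb Py a ja; rewrite -[a](pbw_coK H) [co a]mpolyE linear_sum.
rewrite big_seq; apply: (big_ind P) => // [u v Pu Pv|m].
  by rewrite -[u]scale1r; apply: Pcomb.
rewrite mcoeff_msupp => am0; rewrite linearZ /= -[_ *: _]addr0.
apply: Pcomb => //.
have [/existsP[i /andP[ir m2]]|/existsPn mr] :=
    boolP [exists i : 'I_n, (i < r)%N && (1 < m i)%N].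
  by rewrite (mon_y m2); apply: Py.
rewrite ja ?eqxx // in am0; move=> i ir.
by move: (mr i); rewrite ir /= -leqNgt ltnS.
Qed.

Lemma yideal_mulr r a b : yideal r a -> yideal r (a * b).
Proof.
apply: (yideal_ind (P := fun a => yideal r (a * b))) => [|c u v ju jv|i u ir].
- by rewrite mul0r; apply: yideal0.
- by rewrite mulrDl -scalerAl; apply: yideal_comb.
by rewrite -mulrA; apply: yideal_y.
Qed.

Lemma yideal_mull r a b : yideal r a -> yideal r (b * a).
Proof.
apply: (yideal_ind (P := fun a => yideal r (b * a))) => [|c u v ju jv|i u ir].
- by rewrite mulr0; apply: yideal0.
- by rewrite mulrDr -scalerAr; apply: yideal_comb.
by rewrite mulrA -(pbw_yC H) -mulrA; apply: yideal_y.
Qed.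

(** A left inverse of multiplication by y_i, killing the monomials with m_i < 2. It need not be
    S-linear, but it is k-linear and homogeneous, so composing with it preserves bar cochains; this
    gives the connecting maps a formula. *)
Definition div_y (i : 'I_n) : S -> S :=
  coord_op co mon (fun m => (m + U_(i) *+ 2)%MM) (fun=> 1).

Lemma co_div_y i a m : (co (div_y i a))@_m = (co a)@_(m + U_(i) *+ 2).
Proof. by rewrite (co_coord_op H) ?mul1r // mdegD leq_addr. Qed.

Lemma div_y_comb i c a b : div_y i (c *: a + b) = c *: div_y i a + div_y i b.
Proof. by apply: (coord_op_comb H) => m; rewrite mdegD leq_addr. Qed.

Lemma div_y_grz i j a : grz gr j a -> grz gr (j - 2) (div_y i a).
Proof.
move=> /(grzP H) ja; apply/(grzP H) => m mj; rewrite co_div_y ja //.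
by apply: contraNneq mj => <-; rewrite mdegD mdegMn mdeg1; lia.
Qed.

Lemma yideal_div (i : 'I_n) a : yideal i.+1 a -> yideal i (a - y i * div_y i a).
Proof.
move=> ja m mi; rewrite linearB mcoeffB.
have [m2|m2] := leqP 2 (m i).
  rewrite -(subm_double m2).
  by rewrite co_y_shift co_div_y subrr.
rewrite ja ?sub0r; last first.
  move=> i'; rewrite ltnS leq_eqVlt => /orP[/eqP/val_inj -> //|]; exact: mi.
apply/eqP; rewrite oppr_eq0; apply/eqP; apply: (@yideal_y i.+1 i _ (ltnSn i)) => i'.
rewrite ltnS leq_eqVlt => /orP[/eqP/val_inj -> //|]; exact: mi.
Qed.

Lemma yideal_bar_diff r p (f : cochain S) l : (forall s, size s = p.+1 -> yideal r (f s)) ->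
  size l = p.+2 -> yideal r (bar_diff p f l).
Proof.
by apply: bar_diff_ideal => *; [apply: yideal_comb|apply: yideal_mulr].
Qed.

(** * Ext with coefficients in the quotients by y_0, ..., y_(r-1) *)

Lemma bar_diffB p (f g : cochain S) l :
  bar_diff p (fun s => f s - g s) l = bar_diff p f l - bar_diff p g l.
Proof.
rewrite -[RHS]addrC -scaleN1r -bar_diff_comb /bar_diff; congr (_ + _).
  by apply: eq_bigr => i _; rewrite scaleN1r addrC.
by rewrite scaleN1r addrC.
Qed.

Lemma cochain_div_y i N p j f : cochains N p j f ->
  cochains N p (j - 2) (fun s => div_y i (f s)).
Proof.
by move=> fC; apply: (cochain_comp (i := - 2)) fC;
  [exact: div_y_comb | move=> *; apply: div_y_grz].
Qed.

Lemma cochain_mul_y i N p j f : cochains N p (j - 2) f ->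
  cochains N p j (fun s => y i * f s).
Proof. by move/(cochain_lact H (y_gr i)); rewrite subrK. Qed.

(* Rees' lemma for the regular sequence y: Ext^p(S/S_{>= N}, S/(y_0, ..., y_(r-1)))
   vanishes for p < n - r. *)
Lemma ext_mod_vanish r p N j c : (r + p < n)%N -> cochains N p j c ->
  (forall s, size s = p.+2 -> yideal r (bar_diff p c s)) ->
  exists2 g, coboundaries N p j g & forall s, size s = p.+1 -> yideal r (c s - g s).
Proof.
elim: r p j c => [|r IHr] p j c rp cC cZ.
  exists c; last by move=> s _; rewrite subrr; apply: yideal0.
  apply: (ext_vanish H extk); first by rewrite neq_ltn rp.
  by split => // s /cZ/yideal_eq0.
have rn : (r < n)%N by lia.
(* The connecting map: dc is y_r e modulo y_0, ..., y_(r-1), and since y_r can be cancelled there, e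
   is again a cocycle. *)
pose i := Ordinal rn; pose e s := div_y i (bar_diff p c s).
have eP s : size s = p.+2 -> yideal r (bar_diff p c s - y i * e s).
  by move=> ss; apply: (@yideal_div i); apply: cZ.
have eC : cochains N p.+1 (j - 2) e by apply: cochain_div_y; apply: (cochain_bar_diff H).
have eZ s : size s = p.+3 -> yideal r (bar_diff p.+1 e s).
  move=> ss; apply: (@yideal_y_inj i); rewrite -bar_diff_lact -[bar_diff _ _ _]opprK.
  apply: yidealN; rewrite -sub0r -(bar_diff_sq c ss) -bar_diffB.
  exact: yideal_bar_diff.
have rp1 : (r + p.+1 < n)%N by lia.
(* As r + (p + 1) < n, induction gives e = d c1 modulo y_0, ..., y_(r-1), so c - y_r c1 is a cocycle
   modulo this shorter sequence and induction applies again. *)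
have [g1 [c1 c1C g1E] c1P] := IHr p.+1 (j - 2) e rp1 eC eZ.
have yc1C := cochain_mul_y i c1C.
have rp0 : (r + p < n)%N by lia.
have [||g gB gP] := IHr p j (fun s => c s - y i * c1 s) rp0.
- exact: (cochainB H).
- move=> s ss; rewrite bar_diffB bar_diff_lact.
  rewrite -[X in yideal r X](subrKA (y i * e s)); apply: yidealD; first exact: eP.
  by rewrite -mulrBr; apply: yideal_mull; rewrite -g1E //; apply: c1P.
exists g => // s ss; rewrite -[c s](subrK (y i * c1 s)) addrAC.
apply: yidealD; last exact: (@yideal_y r.+1 i).
by apply: yideal_le (gP s ss).
Qed.

(* A family of cochains lifting a cocycle v_n modulo (y_0, ..., y_(n-1)) through
   the connecting maps Ext^p(-, S/(y_0..y_r)) -> Ext^(p+1)(-, S/(y_0..y_(r-1))). *)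
Definition connecting_chain N (j : int) (v : nat -> cochain S) : Prop :=
  (forall r p, (r + p)%N = n -> cochains N p (j - (2 * p)%:Z) (v r)) /\
  (forall (i : 'I_n) p, (i + p.+1)%N = n -> forall s, size s = p.+2 ->
     yideal i (bar_diff p (v i.+1) s - y i * v i s)).

(** Connecting maps send trivial classes to trivial classes. If v_(r+1) - g lies in (y_0, ..., y_r)
    with g a coboundary, let h be its quotient by y_r; then y_r v_r and y_r dh agree modulo y_0,
    ..., y_(r-1), and y_r cancels. *)
Lemma chain_coboundary N j v : connecting_chain N j v ->
  (forall s, size s = 1%N -> yideal n (v n s)) ->
  coboundaries N n (j - (2 * n)%:Z) (v 0%N).
Proof.
move=> [vC vd] vn.
suff main p r : (r + p)%N = n -> exists2 g, coboundaries N p (j - (2 * p)%:Z) g &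
    forall s, size s = p.+1 -> yideal r (v r s - g s).
  have [g gB gP] := main n 0%N (add0n n); apply: eq_coboundary gB => s ss.
  by apply/eqP; rewrite eq_sym -subr_eq0; apply/eqP/yideal_eq0/gP.
elim: p r => [|p IHp] r rp.
  rewrite addn0 in rp; exists (fun=> 0); first exact: (coboundary0 H).
  by move=> s ss; rewrite subr0 rp; apply: vn.
have rn : (r < n)%N by lia.
have [|g gB gP] := IHp r.+1; first by lia.
pose i := Ordinal rn; pose e s := v r.+1 s - g s; pose h s := div_y i (e s).
have [gC g0] := coboundary_cocycle H gB.
have eC : cochains N p (j - (2 * p)%:Z) e by apply: (cochainB H) => //; apply: vC; lia.
have hC : cochains N p (j - (2 * p.+1)%:Z) h.
  have -> : j - (2 * p.+1)%:Z = j - (2 * p)%:Z - 2 by lia.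
  exact: cochain_div_y.
exists (bar_diff p h); first by exists h.
move=> s ss; apply: (@yideal_y_inj i); rewrite mulrBr.
rewrite -(subrKA (bar_diff p (v r.+1) s)); apply: yidealD.
  by rewrite -opprB; apply: yidealN; apply: (vd i).
have -> : bar_diff p (v r.+1) s = bar_diff p e s by rewrite bar_diffB g0 ?subr0.
rewrite -bar_diff_lact -bar_diffB; apply: yideal_bar_diff => // s' ss'.
by apply: (@yideal_div i); apply: gP.
Qed.

(** The connecting maps are injective in this range. If v_r is dg modulo y_0, ..., y_(r-1), then
    v_(r+1) - y_r g is a cocycle there, hence a coboundary by [ext_mod_vanish]. In degree 0 the only
    coboundary is zero. *)
Lemma coboundary_chain N j v : connecting_chain N j v ->
  coboundaries N n (j - (2 * n)%:Z) (v 0%N) ->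
  forall s, size s = 1%N -> yideal n (v n s).
Proof.
move=> [vC vd] v0.
suff main r p : (r + p)%N = n -> exists2 g, coboundaries N p (j - (2 * p)%:Z) g &
    forall s, size s = p.+1 -> yideal r (v r s - g s).
  have [g g0 gP] := main n 0%N (addn0 n) => s ss.
  by rewrite -[v n s]subr0 -[X in _ - X](g0 s ss); apply: gP.
elim: r p => [|r IHr] p rp.
  rewrite -rp add0n in v0 *; exists (v 0%N) => // s _.
  by rewrite subrr; apply: yideal0.
have rn : (r < n)%N by lia.
have [|G [g gC gE] gP] := IHr p.+1; first by lia.
pose i := Ordinal rn.
have ygC : cochains N p (j - (2 * p)%:Z) (fun s => y i * g s).
  apply: cochain_mul_y; have <- : j - (2 * p.+1)%:Z = j - (2 * p)%:Z - 2 by lia.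
  exact: gC.
have rp0 : (r + p < n)%N by lia.
have cC : cochains N p (j - (2 * p)%:Z) (fun s => v r.+1 s - y i * g s).
  by apply: (cochainB H) ygC; apply: vC; lia.
have [|g' g'B g'P] := ext_mod_vanish rp0 cC.
  move=> s ss; rewrite bar_diffB bar_diff_lact -(subrKA (y i * v r s)).
  apply: yidealD; first by apply: (vd i) => //=; lia.
  by rewrite -mulrBr; apply: yideal_mull; rewrite -gE //; apply: gP.
exists g' => // s ss; rewrite -[v r.+1 s](subrK (y i * g s)) addrAC.
apply: yidealD; last exact: (@yideal_y r.+1 i).
by apply: yideal_le (g'P s ss).
Qed.

(** Centrality of the y_i lets b pass through the division by y_i. *)
Lemma connecting_chain_lact N j v d b : gr d b -> connecting_chain N j v ->
  connecting_chain N (j + d%:Z) (fun r => colim_lact b (v r)).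
Proof.
move=> db [vC vd]; split=> [r p rp|i p ip s ss].
  by rewrite addrAC; apply: (cochain_lact H) => //; apply: vC.
rewrite bar_diff_lact /colim_lact (mulrA (y i)) (pbw_yC H) -mulrA -mulrBr.
by apply: yideal_mull; apply: vd.
Qed.

Lemma connecting_chain_ract N j v d b : gr d b -> connecting_chain N j v ->
  connecting_chain N (j + d%:Z) (fun r => colim_ract (v r) b).
Proof.
move=> db [vC vd]; split=> [r p rp|i p ip [|m s] // ss].
  by rewrite addrAC; apply: (cochain_ract H _ db (vC r p rp)); apply: leq_addr.
by rewrite bar_diff_ract; apply: vd.
Qed.

Lemma connecting_chainB N j v w : connecting_chain N j v -> connecting_chain N j w ->
  connecting_chain N j (fun r s => v r s - w r s).
Proof.
move=> [vC vd] [wC wd]; split=> [r p rp|i p ip s ss].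
  by apply: (cochainB H); [apply: vC|apply: wC].
rewrite bar_diffB mulrBr subrACA.
by apply: yidealB; [apply: vd|apply: wd].
Qed.

Lemma connecting_chain_le N N' j v : (N <= N')%N ->
  connecting_chain N j v -> connecting_chain N' j v.
Proof.
by move=> le [vC vd]; split=> // r p rp; apply: (cochain_le H le); apply: vC.
Qed.

(** A lift to S of the identity of S/(y). The identity of S need not vanish on any S_{>= N}, whereas
    a squarefree monomial has degree at most n, so this lift vanishes on S_{>= n+1}. *)
Definition squarefree_part : S -> S :=
  coord_op co mon id (fun m => [forall i, (m i < 2)%N]%:R).

Lemma squarefree_partP a : yideal n (a - squarefree_part a).
Proof.
move=> m mn; rewrite linearB mcoeffB (co_coord_op H) //.
have -> : [forall i, (m i < 2)%N] by apply/forallP => i; apply: mn.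
by rewrite mul1r subrr.
Qed.

Lemma squarefree_cochain : cochains n.+1 0 0 (fun s => squarefree_part (head 0 s)).
Proof.
split=> [c u v [|? ?] [] // _|m s sp tm|s e ss se gse].
- exact: (coord_op_comb H).
- rewrite /=; apply: (co_inj H) => m'; rewrite linear0 mcoeff0 (co_coord_op H) //.
  have [/forallP m2|_] := boolP [forall i, (m' i < 2)%N]; last by rewrite mul0r.
  move/(tailP H): tm => ->; rewrite ?mulr0 // ltnS mdegE.
  by rewrite -[leqRHS](card_ord n) -sum1_card; apply: leq_sum => i _; rewrite -ltnS.
case: s e ss se gse => [|m []] // [|d []] // _ _ gse.
rewrite add0r /= addn0; apply/(pbw_gr H) => m' md.
have /(pbw_gr H) gm := gse 0%N isT.
by rewrite (co_coord_op H) // gm ?mulr0.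
Qed.

(* The connecting chain started from the identity of S/(y_0, ..., y_(n-1)). *)
Fixpoint koszul_cochain (p : nat) : cochain S :=
  if p is p'.+1 then fun s =>
    if insub (n - p)%N is Some i then div_y i (bar_diff p' (koszul_cochain p') s) else 0
  else fun s => squarefree_part (head 0 s).

Lemma koszul_cochainP p : (p <= n)%N ->
  cochains n.+1 p (0 - (2 * p)%:Z) (koszul_cochain p) /\
  forall s, size s = p.+2 -> yideal (n - p) (bar_diff p (koszul_cochain p) s).
Proof.
elim: p => [_|p IHp pn].
  rewrite subr0 subn0; split=> [|[|m [|a []]] // _]; first exact: squarefree_cochain.
  rewrite bar_diff0E /= -[X in yideal _ X]opprB; apply: yidealN.
  rewrite -(subrKA (m * a)); apply: yidealD; last exact: squarefree_partP.
  by rewrite -mulrBl -opprB mulNr; apply/yidealN/yideal_mulr/squarefree_partP.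
have [wC wd] := IHp (ltnW pn); have rn : (n - p.+1 < n)%N by lia.
pose i := Ordinal rn; have np : (n - p = i.+1)%N by rewrite /=; lia.
rewrite /= insubT -/i; split.
  have -> : 0 - (2 * p.+1)%:Z = 0 - (2 * p)%:Z - 2 by lia.
  by apply: cochain_div_y; apply: (cochain_bar_diff H).
move=> s ss; apply: (@yideal_y_inj i); rewrite -bar_diff_lact -[bar_diff _ _ _]opprK.
apply: yidealN; rewrite -sub0r -(bar_diff_sq (koszul_cochain p) ss) -bar_diffB.
apply: yideal_bar_diff => // s' ss'; apply: (@yideal_div i).
by rewrite -np; apply: wd.
Qed.

Lemma koszul_chain : connecting_chain n.+1 0 (fun r => koszul_cochain (n - r)%N).
Proof.
split=> [r p rp|i p ip s ss].
  have -> : (n - r = p)%N by lia.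
  by have [|wC _] := koszul_cochainP (p := p); first lia.
have -> : (n - i.+1 = p)%N by lia.
have -> : (n - i = p.+1)%N by lia.
have [|_ wd] := koszul_cochainP (p := p); first by lia.
have ni : (n - p.+1 = i)%N by lia.
rewrite /= ni valK; apply: (@yideal_div i).
have <- : (n - p = i.+1)%N by lia.
exact: wd.
Qed.

Definition koszul_class : cochain S := koszul_cochain n.

Lemma koszul_class_cocycle : cocycles n.+1 n (- (2 * n)%:Z) koszul_class.
Proof.
have [wC wd] := koszul_cochainP (leqnn n); split; first by move: wC; rewrite sub0r.
by move=> s ss; apply: yideal_eq0; rewrite -(subnn n); apply: wd.
Qed.

Lemma koszul_lact_null d s : gr d s -> yideal n s ->
  null (- (2 * n)%:Z + d%:Z) (colim_lact s koszul_class).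
Proof.
move=> ds js; exists n.+1; rewrite addrC.
have := chain_coboundary (connecting_chain_lact ds koszul_chain).
rewrite /= subn0 add0r; apply => -[|m []] // _; rewrite subnn /colim_lact /=.
exact: yideal_mulr.
Qed.

(** The difference ends a connecting chain that starts at b times the squarefree part of m, minus
    the squarefree part of b m. Both terms are b m modulo (y). *)
Lemma koszul_central d b : gr d b ->
  null (- (2 * n)%:Z + d%:Z)
    (fun s => colim_lact b koszul_class s - colim_ract koszul_class b s).
Proof.
move=> db; exists n.+1; rewrite addrC.
have := chain_coboundary (connecting_chainB (connecting_chain_lact db koszul_chain)
  (connecting_chain_ract db koszul_chain)).
rewrite /= subn0 add0r; apply => -[|m []] // _; rewrite subnn /colim_lact /colim_ract /=.
rewrite -(subrKA (b * m)); apply: yidealD; last exact: squarefree_partP.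
by rewrite -mulrBr -opprB mulrN; apply/yidealN/yideal_mull/squarefree_partP.
Qed.

(** The chain is tested at m = 1, where it starts at s modulo (y). The level N of the given
    coboundary is arbitrary, so it and n + 1 are first raised to their maximum. *)
Lemma koszul_lact_nonnull d s : gr d s ->
  null (- (2 * n)%:Z + d%:Z) (colim_lact s koszul_class) -> yideal n s.
Proof.
move=> ds [N sB]; rewrite addrC -[d%:Z]add0r in sB.
have le1 := leq_maxl N n.+1; have le2 := leq_maxr N n.+1.
have := coboundary_chain (connecting_chain_le le2 (connecting_chain_lact ds koszul_chain)).
rewrite subn0 => /(_ (coboundary_le H le1 sB))/(_ [:: 1] erefl).
rewrite subnn /colim_lact /= => js.
rewrite -[s]mulr1 -[1](subrK (squarefree_part 1)) mulrDr; apply: yidealD => //.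
exact/yideal_mull/squarefree_partP.
Qed.

End CentralRegularSequence.

(** * Left and right multiplication on the colimit *)

Section Twist.
Variables (k : fieldType) (S : algType k) (gr : nat -> S -> Prop) (n : nat).
Variables (y : 'I_n -> S) (co : {linear S -> {mpoly k[n]}}).
Variable (mon : {linear {mpoly k[n]} -> S}).
Hypothesis H : pbw gr y co mon.
Hypothesis extk : forall p j,
  ext_dim gr (tail gr 1) p j ((p == n) && (j == - n%:Z)).
Variable x : 'I_n -> S.
Hypothesis n_gt0 : (0 < n)%N.
Hypothesis co_x : forall i, co (x i) = 'X_i.
Hypothesis x_anticomm : forall i j, yideal co n (x i * x j + x j * x i).
Hypothesis x_sqr : forall i, yideal co n (x i * x i).
Hypothesis x_top : ~ yideal co n (\prod_(i <- enum 'I_n) x i).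

Local Notation null := (colim_coboundary gr n).
Local Notation ideal := (yideal co n).
Local Notation prodx l := (\prod_(i <- l) x i).
Local Notation zeta := (koszul_class co mon).

Lemma x_gr i : gr 1 (x i).
Proof.
apply/(pbw_gr H) => m m1; rewrite co_x mcoeffX.
by case: (_ =P m) m1 => // <-; rewrite mdeg1.
Qed.

Lemma prodx_gr l : gr (size l) (prodx l).
Proof.
elim: l => [|i l IHl]; first by rewrite big_nil; apply/(gr_conn (pbw_graded H)); exists 1; rewrite scale1r.
by rewrite big_cons; apply: (gr_mul (pbw_graded H) (x_gr i) IHl).
Qed.

Lemma prodx_comm i l : ideal (x i * prodx l - (-1) ^+ size l *: (prodx l * x i)).
Proof.
elim: l => [|j l IHl].
  by rewrite big_nil mulr1 mul1r scale1r subrr; apply: yideal0.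
rewrite big_cons /= exprS mulN1r scaleNr opprK.
have -> : x i * (x j * prodx l) + (-1) ^+ size l *: (x j * prodx l * x i) =
    (x i * x j + x j * x i) * prodx l
    - x j * (x i * prodx l - (-1) ^+ size l *: (prodx l * x i)).
  by rewrite mulrDl mulrBr -scalerAr !mulrA opprB addrA addrAC addrK addrC.
by apply: yidealB; [apply: (yideal_mulr H)|apply: (yideal_mull H)].
Qed.

Lemma signrZ_sqr (e : nat) (a : S) : (-1) ^+ e *: ((-1) ^+ e *: a) = a.
Proof. by rewrite scalerA -exprD addnn -mul2n exprM sqrrN expr1n expr1n scale1r. Qed.

Lemma prodx_commr i l : ideal (prodx l * x i - (-1) ^+ size l *: (x i * prodx l)).
Proof.
have := yideal_comb (- (-1) ^+ size l) (prodx_comm i l) (@yideal0 _ _ _ co n).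
by rewrite addr0 scaleNr scalerBr signrZ_sqr opprB.
Qed.

Lemma prodx_repeat j l : j \in l -> ideal (prodx l * x j).
Proof.
case/splitPr=> l1 l2; rewrite big_cat big_cons /= -!mulrA; apply: (yideal_mull H).
rewrite -[prodx l2 * x j](subrK ((-1) ^+ size l2 *: (x j * prodx l2))) mulrDr.
apply: yidealD; first exact/(yideal_mull H)/prodx_commr.
rewrite -scalerAr mulrA -[_ *: _]addr0; apply: yideal_comb; last exact: yideal0.
exact: (yideal_mulr H).
Qed.

(** s is the product of all generators but x_i, with the sign of moving x_i from the right end back
    to its place. Another x_j repeats a factor, which gives zero modulo (y). Passing x_j through the
    n - 1 factors costs the sign (-1)^(n-1) for every j. *)
Lemma prodx_dual i : exists s, [/\ gr n.-1 s,
  forall j, ideal (x j * s - (-1) ^+ n.-1 *: (s * x j))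
  & forall j, ideal (s * x j - (j == i)%:R *: prodx (enum 'I_n))].
Proof.
have [l1 [l2 El]] : exists l1 l2, enum 'I_n = l1 ++ i :: l2.
  have : i \in enum 'I_n by rewrite mem_enum.
  by case/splitPr=> l1 l2; exists l1, l2.
have sl : size (l1 ++ l2) = n.-1.
  by have := size_enum_ord n; rewrite El !size_cat /= addnS => /(congr1 predn).
exists ((-1) ^+ size l2 *: prodx (l1 ++ l2)); split=> [|j|j].
- rewrite -[_ *: _]addr0; apply: (gr_lin (pbw_graded H)); last exact: (gr_zero (pbw_graded H)).
  by rewrite -sl; apply: prodx_gr.
- rewrite -scalerAr -scalerAl scalerA mulrC -scalerA -scalerBr -[_ *: _]addr0.
  by apply: yideal_comb; [rewrite -sl; apply: prodx_comm|apply: yideal0].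
have [->|ji] := eqVneq j i.
  rewrite scale1r El !big_cat big_cons /= -scalerAl -!mulrA scalerAr.
  rewrite -mulrBr; apply: (yideal_mull H).
  have := yideal_comb ((-1) ^+ size l2) (prodx_commr i l2) (@yideal0 _ _ _ co n).
  by rewrite addr0 scalerBr signrZ_sqr.
rewrite scale0r subr0 -scalerAl -[_ *: _]addr0; apply: yideal_comb; last exact: yideal0.
apply: prodx_repeat; have : j \in enum 'I_n by rewrite mem_enum.
by rewrite El !mem_cat inE (negPf ji).
Qed.

(** * The residue pairing and the class zeta *)

Lemma colim_cocycle_grz i j f a : grz gr i a -> colim_cocycle gr n j f ->
  colim_cocycle gr n (j + i) (colim_ract f a).
Proof.
case: i => d /= ga fZ; first exact: (colim_cocycle_ract H ga).
exists 0%N; apply: eq_cocycle (coboundary_cocycle H (coboundary0 H 0 n _)) => -[|m s] // [ss].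
have [N [fC _]] := fZ; rewrite /colim_ract ga /= mul0r.
by have /= -> := cochain_0 fC ss (erefl : s = [::] ++ s).
Qed.

Lemma null_grz i j f a : grz gr i a -> null j f -> null (j + i) (colim_ract f a).
Proof.
case: i => d /= ga f0; first exact: (null_ract H ga).
apply: eq_null (null0 H _) => -[|m s] // [ss].
have [N /(coboundary_cocycle H)[fC _]] := f0; rewrite /colim_ract ga /= mul0r.
by have /= -> := cochain_0 fC ss (erefl : s = [::] ++ s).
Qed.

Lemma gr_decomp d a : gr d a ->
  a = \sum_(b : 'X_{1..n < d.+1} | mdeg b == d) (co a)@_b *: mon 'X_[b].
Proof.
move=> ga; apply/eqP; rewrite -subr_eq0; apply/eqP/(co_inj H) => m.
rewrite linear0 mcoeff0; have [md|md] := leqP (mdeg m) d.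
  by have /(tailP H) := tail_decomp H (tail_gr H (leqnn d) ga); apply; rewrite ltnS.
have /(pbw_gr H) am := ga; rewrite linearB linear_sum mcoeffB raddf_sum /= am ?gtn_eqF //.
rewrite big1 ?subrr // => b /eqP bd; rewrite linearZ /= mcoeffZ (pbw_monK H) mcoeffX.
by case: (_ =P m) => [bm|_]; [move: md; rewrite -bm bd ltnn|rewrite mulr0].
Qed.

Lemma residue_pairing : exists res : cochain S -> k,
  [/\ forall c f g, colim_cocycle gr n (- n%:Z) f -> colim_cocycle gr n (- n%:Z) g ->
        res (fun s => c *: f s + g s) = c * res f + res g,
      forall f, colim_cocycle gr n (- n%:Z) f -> (null (- n%:Z) f <-> res f = 0)
    & forall m : 'X_{1..n}, exists2 f, colim_cocycle gr n (- n%:Z - (mdeg m)%:Z) f &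
        forall b, mdeg b = mdeg m -> res (colim_ract f (mon 'X_[b])) = (b == m)%:R].
Proof.
have [z [res [zZ resP resI]]] := socle_residue H extk.
have zc : colim_cocycle gr n (- n%:Z) z by exists 1%N.
have resE c f : colim_cocycle gr n (- n%:Z) f ->
    null (- n%:Z) (fun s => f s - c *: z s) -> res f = c.
  move=> fZ fc; apply/eqP; rewrite -subr_eq0; apply/eqP/resI.
  apply: eq_null (nullB H fc (resP f fZ)) => s _.
  by rewrite opprB addrC subrKA scalerBl.
exists res; split=> [c f g fZ gZ|f fZ|m].
- apply: resE; first exact: (colim_cocycle_comb H).
  apply: eq_null (null_comb H c (resP f fZ) (resP g gZ)) => s _.
  by rewrite scalerBr scalerDl scalerA addrACA -opprD.
- split=> [f0|f0].
    by apply: resE => //; apply: eq_null f0 => s _; rewrite scale0r subr0.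
  by apply: eq_null (resP f fZ) => s _; rewrite f0 scale0r subr0.
have [f fZ fb] := dual_cocycle H extk m zZ; exists f => // b bm.
apply: resE.
  have := colim_cocycle_ract H (monX_gr H b) fZ.
  by rewrite bm subrK.
apply: eq_null (null0 H _) => s ss; rewrite fb //.
by rewrite subrr.
Qed.

Lemma koszul_class_generates f : colim_cocycle gr n (- n%:Z - 1) f ->
  exists s, [/\ gr n.-1 s, forall j, ideal (x j * s - (-1) ^+ n.-1 *: (s * x j))
    & null (- n%:Z - 1) (fun l => f l - s * zeta l)].
Proof.
move=> fZ; have [res [reslin resnull _]] := residue_pairing.
set w := prodx (enum 'I_n).
have wn : gr n w by have := prodx_gr (enum 'I_n); rewrite size_enum_ord.
have zetaZ : colim_cocycle gr n (- (2 * n)%:Z) zeta.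
  by exists n.+1; apply: (koszul_class_cocycle H).
have n2n : - (2 * n)%:Z + n%:Z = - n%:Z :> int by lia.
have wZ := colim_cocycle_lact H wn zetaZ; rewrite n2n in wZ.
(* The top product w lies outside (y), so w zeta spans D_(-n) and can serve as the unit for
   coefficients there. *)
have w0 : res (colim_lact w zeta) != 0.
  apply/eqP => /(resnull _ wZ); rewrite -n2n => /(koszul_lact_nonnull H extk wn).
  exact: x_top.
have [dual dualP] : exists dual : 'I_n -> S, forall i, [/\ gr n.-1 (dual i),
  forall j, ideal (x j * dual i - (-1) ^+ n.-1 *: (dual i * x j))
  & forall j, ideal (dual i * x j - (j == i)%:R *: w)].
  exact: (functional_choice (fun i s => [/\ gr n.-1 s,
    forall j, ideal (x j * s - (-1) ^+ n.-1 *: (s * x j))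
    & forall j, ideal (s * x j - (j == i)%:R *: w)]) prodx_dual).
(* Chosen so that s zeta x_j ~ s x_j zeta ~ c_j w zeta ~ f x_j for every j. In degree -n-1, one step
   from the socle, these products determine the class. *)
pose c i := res (colim_ract f (x i)) / res (colim_lact w zeta).
pose s := \sum_i c i *: dual i.
have sn : gr n.-1 s.
  rewrite /s; apply: (big_ind (gr n.-1)) => [|u v gu gv|i _].
  - exact: (gr_zero (pbw_graded H)).
  - by rewrite -[u]scale1r; apply: (gr_lin (pbw_graded H)).
  rewrite -[_ *: _]addr0; apply: (gr_lin (pbw_graded H)); last exact: (gr_zero (pbw_graded H)).
  by have [] := dualP i.
have scomm j : ideal (x j * s - (-1) ^+ n.-1 *: (s * x j)).
  rewrite /s mulr_sumr mulr_suml scaler_sumr -sumrB.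
  apply: (big_ind ideal) => [|u v ju jv|i _]; [exact: yideal0|exact: yidealD|].
  rewrite -scalerAr -scalerAl scalerA [_ ^+ _ * _]mulrC -(scalerA (c i)) -scalerBr -[_ *: _]addr0.
  by apply: yideal_comb; [have [] := dualP i|apply: yideal0].
have sdual j : ideal (s * x j - c j *: w).
  have -> : c j *: w = \sum_i c i *: ((j == i)%:R *: w).
    rewrite (bigD1 j) //= eqxx scale1r big1 ?addr0 // => i; rewrite eq_sym => /negPf ->.
    by rewrite scale0r scaler0.
  rewrite /s mulr_suml -sumrB.
  apply: (big_ind ideal) => [|u v ju jv|i _]; [exact: yideal0|exact: yidealD|].
  rewrite -scalerAl -scalerBr -[_ *: _]addr0.
  by apply: yideal_comb; [have [] := dualP i|apply: yideal0].
exists s; split=> //.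
have nn1 : - (2 * n)%:Z + n.-1%:Z = - n%:Z - 1 :> int by lia.
have szZ := colim_cocycle_lact H sn zetaZ; rewrite nn1 in szZ.
have fsZ := colim_cocycleB H fZ szZ.
apply: (null_by_socle H extk fsZ) => b bn1.
have b1 : mdeg b = 1%N by lia.
have /mdeg1P[i /eqP bi] : mdeg b == 1%N by rewrite b1.
have -> : mon 'X_[b] = x i by apply: (can_inj (pbw_coK H)); rewrite (pbw_monK H) co_x bi.
rewrite bn1.
have n1 : - n%:Z - 1 + 1%:Z = - n%:Z :> int by lia.
have fxZ := colim_cocycle_ract H (x_gr i) fZ; rewrite n1 in fxZ.
have fx0 : null (- n%:Z) (fun l => colim_ract f (x i) l - c i *: (w * zeta l)).
  have dZ : colim_cocycle gr n (- n%:Z)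
      (fun l => - c i *: colim_lact w zeta l + colim_ract f (x i) l).
    exact: (colim_cocycle_comb H).
  apply: (@eq_null _ _ _ _ _ (fun l => - c i *: colim_lact w zeta l + colim_ract f (x i) l)).
    by move=> l _; rewrite scaleNr addrC.
  by apply/(resnull _ dZ); rewrite reslin // mulNr divfK // addNr.
have zx0 : null (- n%:Z) (fun l => s * (x i * zeta l - colim_ract zeta (x i) l)).
  have := null_lact H sn (koszul_central H (x_gr i)).
  by have -> : - (2 * n)%:Z + 1%:Z + n.-1%:Z = - n%:Z :> int by lia.
have sx0 : null (- n%:Z) (fun l => (s * x i - c i *: w) * zeta l).
  rewrite -n2n; apply: (koszul_lact_null H) => //.
  rewrite addrC -scaleNr; apply: (gr_lin (pbw_graded H)) => //.
  by have := gr_mul (pbw_graded H) sn (x_gr i); rewrite addn1 prednK.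
(* (f - s zeta) x_i = (f x_i - c_i w zeta) - (s x_i - c_i w) zeta + s (x_i zeta - zeta x_i). *)
apply: eq_null (nullD H (nullB H fx0 sx0) zx0) => l _.
rewrite /colim_ract /= mulrBl -(scalerAl (c i)) mulrBr mulrA opprB.
by rewrite !subrKA.
Qed.

(* The Nakayama automorphism acts on generators as multiplication by (-1)^(n-1). *)
Lemma ract_lact f i : colim_cocycle gr n (- n%:Z - 1) f ->
  null (- n%:Z) (fun l => x i * f l - (-1) ^+ n.-1 *: colim_ract f (x i) l).
Proof.
move=> fZ; have [s [sn scomm fs]] := koszul_class_generates fZ.
have n1 : - n%:Z - 1 + 1%:Z = - n%:Z :> int by lia.
have n2n : - (2 * n)%:Z + n%:Z = - n%:Z :> int by lia.
have f1 := null_lact H (x_gr i) fs; rewrite n1 in f1.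
have f2 := null_ract H (x_gr i) fs; rewrite n1 in f2.
have zx0 : null (- n%:Z) (fun l => s * (x i * zeta l - colim_ract zeta (x i) l)).
  have := null_lact H sn (koszul_central H (x_gr i)).
  by have -> : - (2 * n)%:Z + 1%:Z + n.-1%:Z = - n%:Z :> int by lia.
have sx0 : null (- n%:Z) (fun l => (x i * s - (-1) ^+ n.-1 *: (s * x i)) * zeta l).
  rewrite -n2n; apply: (koszul_lact_null H) => //.
  rewrite addrC -scaleNr; apply: (gr_lin (pbw_graded H)).
    by have := gr_mul (pbw_graded H) sn (x_gr i); rewrite addn1 prednK.
  by have := gr_mul (pbw_graded H) (x_gr i) sn; rewrite add1n prednK.
(* With e = (-1)^(n-1), the class x f - e f x is the sum of x (f - s zeta), - e (f - s zeta) x, (x s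
   - e s x) zeta and e s (x zeta - zeta x), each of which is null. *)
have := nullD H (nullB H f1 (nullZ H ((-1) ^+ n.-1) f2))
  (nullD H sx0 (nullZ H ((-1) ^+ n.-1) zx0)).
apply: eq_null => l _; rewrite /colim_lact /colim_ract /=.
rewrite !mulrBr !scalerBr mulrBl -!scalerAl !mulrA.
by rewrite [X in _ + X]subrKA subrACA subrK.
Qed.

Hypothesis gr_succ : forall d b, gr d.+1 b ->
  exists2 a : 'I_n -> S, (forall i, gr d (a i)) & b = \sum_i x i * a i.

(** * The residue as a trace for odd n *)

Section Residue.
Variable res : cochain S -> k.
Hypothesis res_comb : forall c f g,
  colim_cocycle gr n (- n%:Z) f -> colim_cocycle gr n (- n%:Z) g ->
  res (fun s => c *: f s + g s) = c * res f + res g.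
Hypothesis res_null : forall f,
  colim_cocycle gr n (- n%:Z) f -> (null (- n%:Z) f <-> res f = 0).

Lemma res_eq f g : colim_cocycle gr n (- n%:Z) f -> colim_cocycle gr n (- n%:Z) g ->
  null (- n%:Z) (fun s => f s - g s) -> res f = res g.
Proof.
move=> fZ gZ d0; apply/eqP; rewrite -subr_eq0 -mulN1r addrC -res_comb //; apply/eqP.
apply/res_null; first exact: (colim_cocycle_comb H).
by apply: eq_null d0 => s _; rewrite scaleN1r addrC.
Qed.

Lemma res_ract_comb j f d c a b : colim_cocycle gr n j f -> j + d%:Z = - n%:Z ->
  gr d a -> gr d b ->
  res (colim_ract f (c *: a + b)) = c * res (colim_ract f a) + res (colim_ract f b).
Proof.
move=> fZ jd ga gb.
have rZ u : gr d u -> colim_cocycle gr n (- n%:Z) (colim_ract f u).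
  by move=> gu; rewrite -jd; apply: (colim_cocycle_ract H).
have cab := gr_lin (pbw_graded H) c ga gb.
rewrite -res_comb; [|exact: rZ|exact: rZ].
apply: res_eq; [exact: rZ|apply: (colim_cocycle_comb H); exact: rZ|].
apply: eq_null (null0 H _) => -[|m s] // [ss].
have [N [[flin _ _] _]] := fZ; rewrite /colim_ract /= mulrDl -scalerAl.
by have /= -> := flin c (a * m) (b * m) [::] s ss; rewrite subrr.
Qed.

Lemma res_sum j f d a : colim_cocycle gr n j f -> j + d%:Z = - n%:Z -> gr d a ->
  res (colim_ract f a) =
  \sum_(b : 'X_{1..n < d.+1} | mdeg b == d) (co a)@_b * res (colim_ract f (mon 'X_[b])).
Proof.
move=> fZ jd ga; rewrite {1}(gr_decomp ga).
have gr0 := gr_zero (pbw_graded H) d.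
have res0 : res (colim_ract f 0) = 0.
  have := res_ract_comb 1 fZ jd gr0 gr0.
  by rewrite scaler0 addr0 mul1r -[LHS]addr0 => /addrI.
set A := (X in colim_ract f X); set B := (RHS); suff [] : gr d A /\ res (colim_ract f A) = B by [].
apply: (big_ind2 (fun u v => gr d u /\ res (colim_ract f u) = v)) => //.
  move=> u v u' v' [gu <-] [gu' <-]; rewrite -[u]scale1r.
  by split; [apply: (gr_lin (pbw_graded H))|rewrite (res_ract_comb _ fZ jd) // mul1r scale1r].
move=> b /eqP bd; have := monX_gr H b; rewrite bd => gb.
rewrite -[_ *: _]addr0; split; first exact: (gr_lin (pbw_graded H)).
by rewrite (res_ract_comb _ fZ jd) // res0 addr0.
Qed.

(** Induction on the degree of b, split into terms x_i a. The case of a, applied to g x_i, gives res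
    (g x_i a) = res (a g x_i). Now a g lies in degree -n-1, where [ract_lact] moves x_i to the left,
    with sign +1 as n is odd. *)
Lemma res_trace d g b : odd n -> gr d b ->
  colim_cocycle gr n (- n%:Z - d%:Z) g ->
  res (colim_ract g b) = res (colim_lact b g).
Proof.
move=> on; elim: d b g => [|d IHd] b g gb gZ.
  have [c ->] := (gr_conn (pbw_graded H) b).1 gb; rewrite subr0 in gZ.
  have gZ1 := colim_cocycle_ract H gb gZ.
  have g1 : gr 0 (c%:A : S) by apply/(gr_conn (pbw_graded H)); exists c.
  have rZ := colim_cocycle_ract H g1 gZ; have lZ := colim_cocycle_lact H g1 gZ.
  rewrite addr0 in rZ lZ; apply: res_eq => //.
  apply: eq_null (null0 H _) => -[|m s] // [ss].
  have [N [gC _]] := gZ; have [glin _ _] := gC.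
  rewrite /colim_ract /colim_lact /= -!scalerAl !mul1r.
  have /= := glin c m 0 [::] s ss.
  have /= -> := cochain_0 gC ss (erefl : s = [::] ++ s).
  by rewrite !addr0 => ->; rewrite subrr.
have [a ga ->] := gr_succ gb.
have xa i : gr d.+1 (x i * a i).
  by rewrite -add1n; apply: (gr_mul (pbw_graded H)) => //; apply: x_gr.
have jd : - n%:Z - d.+1%:Z + d.+1%:Z = - n%:Z :> int by rewrite subrK.
have lZ u : gr d.+1 u -> colim_cocycle gr n (- n%:Z) (colim_lact u g).
  by move=> gu; rewrite -jd; apply: (colim_cocycle_lact H).
suff [] : gr d.+1 (\sum_i x i * a i) /\ res (colim_ract g (\sum_i x i * a i)) =
  res (colim_lact (\sum_i x i * a i) g) by [].
have gr0 := gr_zero (pbw_graded H) d.+1.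
apply: (big_ind (fun u => gr d.+1 u /\ res (colim_ract g u) = res (colim_lact u g))).
- split=> //; have := res_ract_comb 1 gZ jd gr0 gr0.
  rewrite scaler0 addr0 mul1r -[LHS]addr0 => /addrI <-; symmetry.
  by apply/res_null; [exact: lZ|apply: eq_null (null0 H _) => s _; rewrite /colim_lact mul0r].
- move=> u v [gu eu] [gv ev]; have guv : gr d.+1 (u + v).
    by rewrite -[u]scale1r; apply: (gr_lin (pbw_graded H)).
  split=> //; rewrite -[u in LHS]scale1r (res_ract_comb _ gZ jd) // eu ev.
  rewrite -res_comb; [|exact: lZ|exact: lZ]; apply: res_eq.
  + by apply: (colim_cocycle_comb H); apply: lZ.
  + exact: lZ.
  apply: eq_null (null0 H _) => s _.
  by rewrite /colim_lact scale1r mulrDl subrr.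
move=> i _; split=> //.
have gxZ := colim_cocycle_ract H (x_gr i) gZ.
have jx : - n%:Z - d.+1%:Z + 1%:Z = - n%:Z - d%:Z :> int by lia.
rewrite jx in gxZ.
have -> : colim_ract g (x i * a i) = colim_ract (colim_ract g (x i)) (a i).
  by apply: functional_extensionality => s; rewrite /colim_ract /= mulrA.
rewrite (IHd _ _ (ga i) gxZ).
have aZ := colim_cocycle_lact H (ga i) gZ.
have ja : - n%:Z - d.+1%:Z + d%:Z = - n%:Z - 1 :> int by lia.
rewrite ja in aZ.
have j1 : - n%:Z - 1 + 1%:Z = - n%:Z :> int by lia.
have xaZ := colim_cocycle_lact H (x_gr i) aZ; rewrite j1 in xaZ.
have axZ := colim_cocycle_ract H (x_gr i) aZ; rewrite j1 in axZ.
have := ract_lact i aZ; have -> : (-1) ^+ n.-1 = 1 :> k.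
  by rewrite -signr_odd; move: on; rewrite -{1}(prednK n_gt0) /= => /negPf ->.
move=> d0; symmetry.
have -> : colim_lact (x i * a i) g = colim_lact (x i) (colim_lact (a i) g).
  by apply: functional_extensionality => s; rewrite /colim_lact mulrA.
apply: (res_eq xaZ axZ).
by apply: eq_null d0 => s _; rewrite scale1r.
Qed.

End Residue.

(** Suppose n is even and let phi be the image of 1. Being the image of x_i from either side forces
    phi(f x_i) = phi(x_i f), while [ract_lact] gives phi(f x_i) = -phi(x_i f). As 2 is invertible,
    x_i maps to zero, against injectivity. *)
Lemma even_not_calabi_yau : [pchar k] =i pred0 -> calabi_yau gr n -> odd n.
Proof.
move=> char0 [theta tP]; apply: contraT => en.
have gr1 : grz gr (n%:Z - n%:Z) 1.
  by rewrite subrr; apply/(gr_conn (pbw_graded H)); exists 1; rewrite scale1r.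
pose i := Ordinal n_gt0; pose phi := theta n%:Z 1.
have [philin phinull] := theta_omega tP gr1; rewrite -/phi in philin phinull.
have grx : grz gr ((n%:Z + 1%:Z) - n%:Z) (x i).
  by have -> : n%:Z + 1%:Z - n%:Z = 1%:Z :> int by [lia]; apply: x_gr.
suff x0 : x i = 0.
  have := co_x i; rewrite x0 linear0 => /(congr1 (mcoeff U_(i)%MM)).
  by rewrite mcoeff0 mcoeffX eqxx => /eqP; rewrite eq_sym oner_eq0.
apply: (theta_inj tP grx) => f fZ.
have el := theta_lact tP gr1 (x_gr i) fZ; rewrite mulr1 in el.
have er := theta_ract tP gr1 (x_gr i) fZ; rewrite mul1r in er.
have e := etrans (esym el) er; rewrite el; rewrite /omega_lact /omega_ract -/phi in e *.
have jE : - (n%:Z + 1%:Z) = - n%:Z - 1 :> int by lia.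
rewrite jE in fZ; have j1 : - n%:Z - 1 + 1%:Z = - n%:Z :> int by lia.
have lZ := colim_cocycle_lact H (x_gr i) fZ; rewrite j1 in lZ.
have rZ := colim_cocycle_ract H (x_gr i) fZ; rewrite j1 in rZ.
have := ract_lact i fZ; have -> : (-1) ^+ n.-1 = - 1 :> k.
  by rewrite -signr_odd; move: en; rewrite -{1}(prednK n_gt0) /= negbK => ->.
move=> d0.
have : phi (fun s => 1 *: colim_ract f (x i) s + colim_lact (x i) f s) = 0.
  apply: phinull; first exact: (colim_cocycle_comb H).
  by apply: eq_null d0 => s _; rewrite scale1r scaleN1r opprK addrC.
rewrite philin // mul1r -e -mulr2n -mulr_natl => /eqP.
rewrite mulf_eq0 => /orP[|/eqP //].
by have := char0 2; rewrite !inE /= => ->.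
Qed.

(** The isomorphism sends a to the form f |-> res (f a). Compatibility with the left action is
    associativity of the right action on D; the right action is where oddness enters, through
    [res_trace]. *)
Lemma odd_calabi_yau : odd n -> calabi_yau gr n.
Proof.
move=> on; have [res [res_comb res_null dual]] := residue_pairing.
have ractZ j f a : colim_cocycle gr n (- j) f -> grz gr (j - n%:Z) a ->
    colim_cocycle gr n (- n%:Z) (colim_ract f a).
  move=> fZ ga; have := colim_cocycle_grz ga fZ.
  by have -> : - j + (j - n%:Z) = - n%:Z by lia.
exists (fun _ a f => res (colim_ract f a)); split.
- move=> j a ga; split=> [c f g fZ gZ|f fZ f0].
    exact: res_comb (ractZ _ _ _ fZ ga) (ractZ _ _ _ gZ ga).
  apply/(res_null _ (ractZ _ _ _ fZ ga)).
  have := null_grz ga f0.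
  by have -> : - j + (j - n%:Z) = - n%:Z by lia.
- move=> j c a b ga gb f fZ.
  have gab := grz_comb H c ga gb.
  rewrite -res_comb; [|exact: ractZ fZ ga|exact: ractZ fZ gb].
  apply: (res_eq res_comb res_null); first exact: ractZ fZ gab.
    by apply: (colim_cocycle_comb H); [exact: ractZ fZ ga|exact: ractZ fZ gb].
  apply: eq_null (null0 H _) => -[|m s] // [ss].
  have [N [[flin _ _] _]] := fZ; rewrite /colim_ract /= mulrDl -scalerAl.
  by have /= -> := flin c (a * m) (b * m) [::] s ss; rewrite subrr.
- move=> j a; case ej: (j - n%:Z) => [d|d] //= ga a0.
  have jd : - j + d%:Z = - n%:Z by lia.
  apply: (co_inj H) => m; rewrite linear0 mcoeff0.
  have [md|/eqP md] := eqVneq (mdeg m) d; last by move/(pbw_gr H): ga; apply; apply/eqP.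
  have [f fZ fb] := dual m; rewrite md in fb fZ.
  have jn : - n%:Z - d%:Z = - j by lia.
  rewrite jn in fZ; have := a0 f fZ.
  rewrite (res_sum res_comb res_null fZ jd ga).
  have md1 : (mdeg m < d.+1)%N by rewrite md.
  rewrite (bigD1 (BMultinom md1)) /= ?md // fb // eqxx mulr1 big1 ?addr0 // => b /andP[/eqP bd].
  by rewrite -val_eqE /= fb // => /negPf ->; rewrite mulr0.
- move=> j phi [philin phinull].
  case ej: (j - n%:Z) => [d|d]; last first.
    (* Here j < n, so no monomial b carries degree -j down to -n, and every class of degree -j is
       null. *)
    exists 0 => // f fZ; rewrite phinull //.
      by apply/res_null; [apply: (ractZ _ _ _ fZ); apply: (grz0 H)|
        apply: eq_null (null0 H _) => -[|m s] // [ss];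
        have [N [fC _]] := fZ; rewrite /colim_ract /= mul0r;
        have /= -> := cochain_0 fC ss (erefl : s = [::] ++ s)].
    by apply: (null_by_socle H extk fZ) => b; lia.
  have jd : - j + d%:Z = - n%:Z by lia.
  have jn : - n%:Z - d%:Z = - j by lia.
  have [F FP] : exists F : 'X_{1..n} -> cochain S, forall m, mdeg m = d ->
      colim_cocycle gr n (- j) (F m) /\
      forall b, mdeg b = d -> res (colim_ract (F m) (mon 'X_[b])) = (b == m)%:R.
    apply: (functional_choice (fun m f => mdeg m = d -> colim_cocycle gr n (- j) f /\
      forall b, mdeg b = d -> res (colim_ract f (mon 'X_[b])) = (b == m)%:R)) => m.
    have [f fZ fb] := dual m; exists f => md; rewrite -jn -md.
    by split=> // b bd; apply: fb.
  (* The coordinates of a are the values of phi on the classes dual to the monomials of degree d. *)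
  pose a := \sum_(b : 'X_{1..n < d.+1} | mdeg b == d) phi (F b) *: mon 'X_[b].
  have ga : gr d a.
    apply: (big_ind (gr d)) => [|u v gu gv|b /eqP bd].
    - exact: (gr_zero (pbw_graded H)).
    - by rewrite -[u]scale1r; apply: (gr_lin (pbw_graded H)).
    have := monX_gr H b; rewrite bd => gb; rewrite -[_ *: _]addr0.
    by apply: (gr_lin (pbw_graded H)) => //; apply: (gr_zero (pbw_graded H)).
  have coa (b : 'X_{1..n < d.+1}) : mdeg b = d -> (co a)@_b = phi (F b).
    move=> bd; rewrite linear_sum raddf_sum /= (bigD1 b) ?bd //=.
    rewrite linearZ /= mcoeffZ (pbw_monK H) mcoeffX eqxx mulr1 big1 ?addr0 // => b'.
    case/andP=> _ nb; rewrite linearZ /= mcoeffZ (pbw_monK H) mcoeffX.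
    by rewrite -val_eqE in nb; rewrite (negPf nb) mulr0.
  exists a => // f fZ; rewrite (res_sum res_comb res_null fZ jd ga).
  have monZ g (m : 'X_{1..n}) : colim_cocycle gr n (- j) g -> mdeg m = d ->
      colim_cocycle gr n (- n%:Z) (colim_ract g (mon 'X_[m])).
    by move=> gZ md; rewrite -jd -md; apply: (colim_cocycle_ract H (monX_gr H m)).
  pose c b := res (colim_ract f (mon 'X_[b])).
  (* G expands f in the dual classes, so f - G is null and phi f = phi G. It is built one monomial
     at a time because phi is known to be linear only on two cocycles at once. *)
  have [G [GZ phiG resG]] : exists G, [/\ colim_cocycle gr n (- j) G,
      phi G = \sum_(b : 'X_{1..n < d.+1} | mdeg b == d) c b * phi (F b)
    & forall b', mdeg b' = d -> res (colim_ract G (mon 'X_[b'])) =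
      \sum_(b : 'X_{1..n < d.+1} | mdeg b == d) c b * (b' == b)%:R].
    elim: (index_enum _) => [|b r [G [GZ phiG resG]]].
      have z0 : null (- j) (fun=> 0) := null0 H _.
      have zZ : colim_cocycle gr n (- j) (fun=> 0).
        by exists 0%N; apply: (coboundary_cocycle H); apply: (coboundary0 H).
      exists (fun=> 0); split=> [//||b' bd']; rewrite big_nil; first exact: phinull.
      have /= := null_ract H (monX_gr H b') z0; rewrite bd' jd => r0.
      by apply/res_null => //; apply: monZ.
    have [/eqP bd|/negPf bd] := boolP (mdeg b == d); last first.
      by exists G; split=> // [|b' bd']; rewrite big_cons bd // resG.
    have [FZ Fb] := FP b bd.
    exists (fun s => c b *: F b s + G s); split.
    - exact: (colim_cocycle_comb H).
    - by rewrite philin // phiG big_cons bd eqxx.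
    move=> b' bd'; rewrite big_cons bd eqxx -(Fb b' bd') -(resG b' bd').
    by rewrite -res_comb //; apply: monZ.
  have dZ : colim_cocycle gr n (- j) (fun s => - 1 *: G s + f s).
    exact: (colim_cocycle_comb H).
  have d0 : null (- j) (fun s => - 1 *: G s + f s).
    apply: (null_by_socle H extk dZ) => b bj.
    have bd : mdeg b = d by lia.
    have fbZ := monZ f b fZ bd; have GbZ := monZ G b GZ bd.
    rewrite bj; apply/res_null; first exact: (colim_cocycle_comb H).
    rewrite res_comb // resG //.
    have bd1 : (mdeg b < d.+1)%N by rewrite bd.
    rewrite (bigD1 (BMultinom bd1)) /= ?bd // eqxx mulr1 big1 ?addr0.
      by rewrite mulN1r addNr.
    by move=> b' /andP[_]; rewrite -val_eqE /= eq_sym => /negPf ->; rewrite mulr0.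
  have := phinull _ dZ d0; rewrite philin // mulN1r addrC => /eqP.
  rewrite subr_eq0 => /eqP ->; rewrite phiG; apply: eq_bigr => b /eqP bd.
  by rewrite coa // mulrC.
- move=> j d a b ga gb f fZ; congr res.
  by apply: functional_extensionality => s; rewrite /omega_lact /colim_ract /= mulrA.
move=> j d a b ga gb f fZ; rewrite /omega_ract.
have jE : - (j + d%:Z) + (j - n%:Z) = - n%:Z - d%:Z by lia.
have faZ := colim_cocycle_grz ga fZ; rewrite jE in faZ.
rewrite -[RHS](res_trace res_comb res_null on gb faZ); congr res.
by apply: functional_extensionality => s; rewrite /colim_ract /= mulrA.
Qed.

End Twist.

(** * The monomial basis of a Clifford algebra *)

(** A factor 1 - t takes differences of consecutive coefficients, so induction on n reduces the
    claim to Pascal's rule. *)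
Lemma hilbert_series_qpa n (g : nat -> int) :
  (forall i, \sum_(j < i.+1) ((1 - 'X) ^+ n.+1 : {poly int})`_j * g (i - j)%N
     = (i == 0)%:R) ->
  forall i, g i = 'C(i + n, i)%:R.
Proof.
have step q (f : nat -> int) i :
    \sum_(j < i.+1) ((1 - 'X) * q : {poly int})`_j * f (i - j)%N =
    \sum_(j < i.+1) q`_j * (f (i - j)%N - if (i - j)%N is t.+1 then f t else 0).
  under eq_bigr do rewrite mulrBl mul1r coefB coefXM mulrBl.
  under [RHS]eq_bigr do rewrite mulrBr.
  rewrite !sumrB; congr (_ - _).
  rewrite big_ord_recl big_ord_recr /= mul0r add0r subnn mulr0 addr0.
  apply: eq_bigr => j _; rewrite /= /bump /= add1n.
  by rewrite -[(i - j)%N]prednK ?subn_gt0 // -subnS.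
elim: n g => [|n IHn] g gE i.
  have gS t : g t - (if t is t'.+1 then g t' else 0) = (t == 0)%:R.
    rewrite -gE expr1 -[1 - 'X]mulr1 step big_ord_recl /= coef1 eqxx mul1r subn0.
    by rewrite big1 ?addr0 // => j _; rewrite coef1 mul0r.
  elim: i => [|i IHi]; first by have := gS 0; rewrite subr0.
  by have := gS i.+1; rewrite IHi !addn0 !binn => /eqP; rewrite subr_eq0 => /eqP.
have gS t : g t - (if t is t'.+1 then g t' else 0) = 'C(t + n, t)%:R.
  apply: (IHn (fun t => g t - (if t is t'.+1 then g t' else 0))) => t'.
  by rewrite -step -exprS.
elim: i => [|i IHi]; first by have := gS 0; rewrite subr0 !bin0.
have := gS i.+1; rewrite IHi => /eqP; rewrite subr_eq => /eqP ->.
by rewrite -natrD [(i.+1 + n.+1)%N]addnS binS -(addSnnS i n).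
Qed.

(** A spanning family of the right size is free: its square matrix L in the basis b has a one-sided
    inverse M, hence is invertible, and a relation c satisfies c L = 0. *)
Lemma dim_eq_free (k : fieldType) (V : lmodType k) (P : V -> Prop) d (v : 'I_d -> V) :
  dim_eq P d -> P 0 -> (forall t, P (v t)) ->
  (forall u, P u -> exists c : 'I_d -> k, u = \sum_t c t *: v t) ->
  forall c : 'I_d -> k, \sum_t c t *: v t = 0 -> forall t, c t = 0.
Proof.
move=> [b [bP bU]] P0 vP vspan c cv t.
have [M MP] : exists M : 'I_d -> 'I_d -> k, forall t, b t = \sum_s M t s *: v s.
  apply: (functional_choice (fun t m => b t = \sum_s m s *: v s)) => u.
  exact: vspan.
have [L LP] : exists L : 'I_d -> {ffun 'I_d -> k}, forall t, v t = \sum_s L t s *: b s.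
  apply: (functional_choice (fun t (l : {ffun 'I_d -> k}) => v t = \sum_s l s *: b s)) => u.
  by have [l [lE _]] := bU _ (vP u); exists l.
pose MM : 'M[k]_d := \matrix_(i, j) M i j; pose LL : 'M[k]_d := \matrix_(i, j) L i j.
have expand (e : 'I_d -> k) :
    \sum_s e s *: v s = \sum_u (\sum_s e s * L s u) *: b u.
  under [RHS]eq_bigr do rewrite scaler_suml.
  rewrite exchange_big; apply: eq_bigr => s _ /=.
  by rewrite {1}LP scaler_sumr; apply: eq_bigr => u _; rewrite scalerA.
have ML : MM *m LL = 1%:M.
  apply/matrixP => i j; rewrite !mxE.
  have [l [_ lU]] := bU _ (bP i).
  have e1 : l = [ffun u => \sum_s M i s * L s u].
    by apply: lU; rewrite {1}MP expand; apply: eq_bigr => u _; rewrite ffunE.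
  have e2 : l = [ffun u => (i == u)%:R].
    apply: lU; rewrite (bigD1 i) //= ffunE eqxx scale1r big1 ?addr0 // => u.
    by rewrite ffunE eq_sym => /negPf ->; rewrite scale0r.
  have /ffunP/(_ j) := etrans (esym e1) e2; rewrite !ffunE => <-.
  by apply: eq_bigr => s _; rewrite !mxE.
pose cc : 'rV[k]_d := \row_j c j.
have ccL : cc *m LL = 0.
  apply/rowP => u; rewrite !mxE.
  have [l [_ lU]] := bU _ P0.
  have e1 : l = [ffun u => \sum_s c s * L s u].
    apply: lU; have := expand c; rewrite cv => e; apply: (etrans e).
    by apply: eq_bigr => s _; rewrite ffunE.
  have e2 : l = [ffun=> 0].
    by apply: lU; rewrite big1 // => s _; rewrite ffunE scale0r.
  have /ffunP/(_ u) := etrans (esym e1) e2; rewrite !ffunE; apply: etrans.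
  by apply: eq_bigr => s _; rewrite !mxE.
have : cc = 0 by rewrite -[cc]mulmx1 -(mulmx1C ML) mulmxA ccL mul0mx.
by move/rowP/(_ t); rewrite !mxE.
Qed.

Lemma linear_function (k : fieldType) (U V : lmodType k) (f : U -> V) :
  linear f -> exists g : {linear U -> V}, g =1 f.
Proof.
move=> lf; pose g : {linear U -> V} := HB.pack f (GRing.isLinear.Build k U V *:%R f lf).
by exists g.
Qed.

Section CliffordBasis.
Variables (k : fieldType) (S : algType k) (gr : nat -> S -> Prop) (n : nat).
Variables (F : n.-tuple 'M[k]_n) (x y : 'I_n -> S).
Hypothesis two_neq0 : 2%:R != 0 :> k.
Hypothesis grS : connected_graded gr.
Hypothesis x_gr1 : forall i, gr 1 (x i).
Hypothesis y_gr2 : forall i, gr 2 (y i).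
Hypothesis xx : forall i j, x i * x j + x j * x i = \sum_m tnth F m i j *: y m.
Hypothesis xy : forall i j, x i * y j = y j * x i.
Hypothesis yy : forall i j, y i * y j = y j * y i.
Hypothesis generated : forall P : S -> Prop, P 0 -> P 1 ->
  (forall c u v, P u -> P v -> P (c *: u + v)) ->
  (forall i a, P a -> P (x i * a)) -> (forall i a, P a -> P (y i * a)) ->
  forall a, P a.

Lemma y_central i a : y i * a = a * y i.
Proof.
move: a; apply: generated => [||c u v eu ev|j a e|j a e].
- by rewrite mulr0 mul0r.
- by rewrite mulr1 mul1r.
- by rewrite mulrDr mulrDl -scalerAr -scalerAl eu ev.
- by rewrite mulrA -xy -mulrA e mulrA.
- by rewrite mulrA yy -mulrA e mulrA.
Qed.

Definition pbw_prod (m : 'X_{1..n}) (l : seq 'I_n) : S :=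
  \prod_(i <- l) (x i ^+ odd (m i) * y i ^+ (m i)./2).

Definition pbw_mon (m : 'X_{1..n}) : S := pbw_prod m (enum 'I_n).

Lemma yX_central i e a : y i ^+ e * a = a * y i ^+ e.
Proof. by apply: commr_sym; apply: commrX; apply: commr_sym; apply: y_central. Qed.

Lemma eq_pbw_prod (m m' : 'X_{1..n}) (l : seq 'I_n) : {in l, forall i, m i = m' i} -> pbw_prod m l = pbw_prod m' l.
Proof. by move=> e; rewrite /pbw_prod !big_seq; apply: eq_bigr => i /e ->. Qed.

Lemma pbw_mon_y (m : 'X_{1..n}) i : pbw_mon (m + U_(i) *+ 2) = y i * pbw_mon m.
Proof.
rewrite /pbw_mon; have := mem_enum predT i; have := enum_uniq 'I_n.
elim: (enum _) => [//|j l IHl] /= /andP[jl ul]; rewrite inE.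
have [ij _|ij /= il] := eqVneq i j; last first.
  rewrite /pbw_prod !big_cons -/(pbw_prod _ _) IHl // mnmDE mulmnE mnm1E (negPf ij).
  by rewrite mul0n addn0 mulrA -y_central -mulrA.
rewrite -ij in jl *.
rewrite /pbw_prod !big_cons mnmDE mulmnE mnm1E eqxx mul1n addn2 /= negbK exprS.
rewrite !mulrA y_central; congr (_ * _); apply: eq_pbw_prod => j' j'l.
rewrite mnmDE mulmnE mnm1E; case: eqP => [e|_]; last by rewrite mul0n addn0.
by move: jl; rewrite e j'l.
Qed.

(** Only powers of the central y_j stand before the place of x_i, and that place is still empty
    because m_i is even. *)
Lemma pbw_mon_x (m : 'X_{1..n}) (i : 'I_n) : (forall j : 'I_n, (j <= i)%N -> ~~ odd (m j)) ->
  pbw_mon (m + U_(i)) = x i * pbw_mon m.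
Proof.
move=> mi; rewrite /pbw_mon; have := mem_enum predT i; have := enum_uniq 'I_n.
have : sorted ltn (map val (enum 'I_n)) by rewrite val_enum_ord iota_ltn_sorted.
elim: (enum _) => [//|j l IHl] /= jsort /andP[jl ul]; rewrite inE.
have [ij _|ij /= il] := eqVneq i j; last first.
  have ji : (j < i)%N.
    move: jsort; rewrite path_sortedE; last exact: ltn_trans.
    by case/andP => /allP/(_ i) h _; apply: h; apply: map_f.
  rewrite /pbw_prod !big_cons -/(pbw_prod _ _) IHl //; last exact: path_sorted jsort.
  rewrite mnmDE mnm1E (negPf ij) addn0 (negPf (mi j (ltnW ji))) !mul1r.
  by rewrite !mulrA yX_central.
rewrite -ij in jl *.
rewrite /pbw_prod !big_cons mnmDE mnm1E eqxx addn1 /= (mi i (leqnn i)) /=.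
rewrite (negPf (mi i (leqnn i))) uphalf_half (negPf (mi i (leqnn i))) add0n.
rewrite !mul1r mulrA; congr (_ * _); apply: eq_pbw_prod => j' j'l.
rewrite mnmDE mnm1E; case: eqP => [e|_]; last by rewrite addn0.
by move: jl; rewrite e j'l.
Qed.

Lemma pbw_mon0 : pbw_mon 0 = 1.
Proof. by rewrite /pbw_mon /pbw_prod big1 // => i _; rewrite mnm0E mul1r. Qed.

Lemma pbw_monU i : pbw_mon U_(i) = x i.
Proof.
by rewrite -[X in pbw_mon X]add0m pbw_mon_x ?pbw_mon0 ?mulr1 // => j _; rewrite mnm0E.
Qed.

Lemma pbw_mon_top : pbw_mon [multinom 1%N | _ < n] = \prod_(i <- enum 'I_n) x i.
Proof. by apply: eq_bigr => i _; rewrite mnmE /= mulr1. Qed.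

Lemma pbw_mon_gr m : gr (mdeg m) (pbw_mon m).
Proof.
have gr1 : gr 0 1 by apply/(gr_conn grS); exists 1; rewrite scale1r.
have grX d a e : gr d a -> gr (d * e)%N (a ^+ e).
  move=> ga; elim: e => [|e IHe]; first by rewrite muln0.
  by rewrite mulnS exprS; apply: (gr_mul grS).
rewrite mdegE -big_enum /= /pbw_mon /pbw_prod.
apply: (big_ind2 (fun a d => gr d a)) => // [a d b e ga gb|i _].
  exact: (gr_mul grS).
have := gr_mul grS (grX 1 _ (odd (m i)) (x_gr1 i)) (grX 2 _ (m i)./2 (y_gr2 i)).
by rewrite mul1n mul2n odd_double_half.
Qed.

(* Straightening goes by descending induction on r, as x_r maps the span for r + 1
   into the span for r. *)
Definition pbw_span (r : nat) (a : S) : Prop :=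
  forall P : S -> Prop, P 0 -> (forall c u v, P u -> P v -> P (c *: u + v)) ->
    (forall m : 'X_{1..n}, (forall j : 'I_n, (j < r)%N -> ~~ odd (m j)) -> P (pbw_mon m)) ->
    P a.

Lemma pbw_span0 r : pbw_span r 0. Proof. by []. Qed.

Lemma pbw_span_comb r c u v : pbw_span r u -> pbw_span r v -> pbw_span r (c *: u + v).
Proof. by move=> ru rv P P0 Pc Pm; apply: (Pc); [apply: ru|apply: rv]. Qed.

Lemma pbw_span_le r r' a : (r <= r')%N -> pbw_span r' a -> pbw_span r a.
Proof.
move=> le ra P P0 Pc Pm; apply: ra => // m mr; apply: Pm => j jr.
by apply: mr; apply: leq_trans jr le.
Qed.

Lemma pbw_span_y r i a : pbw_span r a -> pbw_span r (y i * a).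
Proof.
move=> ra; apply: (ra (fun a => pbw_span r (y i * a))) => [|c u v ru rv|m mr].
- by rewrite mulr0.
- by rewrite mulrDr -scalerAr; apply: pbw_span_comb.
rewrite -pbw_mon_y => P _ _; apply => j jr.
by rewrite mnmDE mulmnE oddD oddM andbF addbF; apply: mr.
Qed.

Lemma pbw_span_xS (i : 'I_n) a : pbw_span i.+1 a -> pbw_span i (x i * a).
Proof.
move=> ra; apply: (ra (fun a => pbw_span i (x i * a))) => [|c u v ru rv|m mi].
- by rewrite mulr0.
- by rewrite mulrDr -scalerAr; apply: pbw_span_comb.
rewrite -pbw_mon_x // => P _ _; apply => j ji.
by rewrite mnmDE mnm1E -val_eqE /= gtn_eqF // addn0; apply: mi; apply: ltnW.
Qed.

Lemma xx_span r i j a : pbw_span r a ->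
  pbw_span r ((x i * x j + x j * x i) * a).
Proof.
move=> ra; rewrite xx mulr_suml; apply: (big_ind (pbw_span r)) => [//|u v ru rv|m _].
  by rewrite -[u]scale1r; apply: pbw_span_comb.
rewrite -scalerAl -[_ *: _]addr0; apply: pbw_span_comb; last exact: pbw_span0.
exact: pbw_span_y.
Qed.

(** Induction on n - r, the case i < r being [pbw_span_xS]. Otherwise a monomial either has m_r
    even, and lies in the span for r + 1, or is x_r m' with m' in that span. Then x_i x_r m' is -
    x_r (x_i m') plus a combination of the y times m', and x_i m' stays in the span for r + 1 by
    induction. For i = r the square is half an anticommutator. *)
Lemma pbw_span_x r (i : 'I_n) a : pbw_span r a -> pbw_span (minn i r) (x i * a).
Proof.
have lt_span s (j : 'I_n) b : (j < s)%N -> pbw_span s b -> pbw_span (minn j s) (x j * b).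
  move=> js sb; rewrite (minn_idPl (ltnW js)).
  by apply: pbw_span_xS; apply: pbw_span_le sb.
move: {2}(n - r)%N (leqnn (n - r)) => e.
elim: e r i a => [|e IHe] r i a nr ra.
  by apply: lt_span => //; apply: leq_trans (ltn_ord i) _; rewrite -subn_eq0 -leqn0.
have [ir|] := boolP (i < r)%N; first by apply: lt_span.
rewrite -leqNgt => ri.
rewrite (minn_idPr ri).
have rn : (r < n)%N by apply: leq_ltn_trans ri (ltn_ord i).
have nr1 : (n - r.+1 <= e)%N by lia.
pose o := Ordinal rn.
apply: (ra (fun a => pbw_span r (x i * a))) => [|c u v ru rv|m mr].
- by rewrite mulr0.
- by rewrite mulrDr -scalerAr; apply: pbw_span_comb.
have [mo|mo] := boolP (odd (m o)); last first.
  have : pbw_span r.+1 (pbw_mon m).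
    move=> P _ _; apply => j; rewrite ltnS leq_eqVlt => /orP[/eqP jr|]; last exact: mr.
    by rewrite (_ : j = o) //; apply: val_inj.
  by move/(IHe _ i _ nr1); apply: pbw_span_le; rewrite leq_min ri leqnSn.
have m1 : (U_(o) <= m)%MM by rewrite lep1mP; case: (m o) mo.
pose m' := (m - U_(o))%MM.
have m'r (j : 'I_n) : (j <= o)%N -> ~~ odd (m' j).
  rewrite leq_eqVlt mnmBE mnm1E => /orP[/eqP/val_inj ->|jr].
    by rewrite eqxx; case: (m o) mo => //= q; rewrite subn1.
  by rewrite -val_eqE /= gtn_eqF // subn0; apply: mr.
have m'S : pbw_span r.+1 (pbw_mon m') by move=> P _ _; apply => j; apply: m'r.
have -> : pbw_mon m = x o * pbw_mon m' by rewrite -pbw_mon_x // submK.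
have [io|io] := eqVneq i o.
  rewrite io mulrA.
  have -> : x o * x o = 2%:R^-1 *: (x o * x o + x o * x o).
    by rewrite -mulr2n -scaler_nat scalerA mulVf // scale1r.
  rewrite -scalerAl -[_ *: _]addr0; apply: pbw_span_comb; last exact: pbw_span0.
  by apply: xx_span; apply: pbw_span_le m'S.
have {}ri : (r < i)%N by rewrite ltn_neqAle ri andbT eq_sym -(inj_eq val_inj) in io *.
have -> : x i * (x o * pbw_mon m') =
    - 1 *: (x o * (x i * pbw_mon m')) + (x i * x o + x o * x i) * pbw_mon m'.
  by rewrite scaleN1r mulrDl !mulrA addrCA addNr addr0.
apply: pbw_span_comb; last by apply: xx_span; apply: pbw_span_le m'S.
apply: (@pbw_span_xS o); have := IHe _ i _ nr1 m'S.
by rewrite (minn_idPr ri).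
Qed.

Lemma pbw_spanning a : pbw_span 0 a.
Proof.
move: a; apply: generated => [||c u v|i a|i a].
- exact: pbw_span0.
- by move=> P _ _; rewrite -pbw_mon0; apply => j _; rewrite mnm0E.
- exact: pbw_span_comb.
- by move/pbw_span_x => /(_ i); rewrite minn0.
exact: pbw_span_y.
Qed.

Hypothesis n_gt0 : (0 < n)%N.
Hypothesis hilb : hilbert_qpa gr n.
Hypothesis y_gen : forall m, exists2 a : 'I_n -> S,
  (forall i, gr 1 (a i)) & y m = \sum_i x i * a i.

Lemma gr_combS d c u v : gr d u -> gr d v -> gr d (c *: u + v).
Proof. exact: (gr_lin grS). Qed.

Lemma gr_sumS d (I : Type) (r : seq I) (P : pred I) (f : I -> S) :
  (forall t, P t -> gr d (f t)) -> gr d (\sum_(t <- r | P t) f t).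
Proof.
move=> gf; apply: (big_ind (gr d)) => // [|u v gu gv]; first exact: (gr_zero grS).
by rewrite -[u]scale1r; apply: gr_combS.
Qed.

Lemma gr_scaleS d c u : gr d u -> gr d (c *: u).
Proof. by move=> gu; rewrite -[_ *: _]addr0; apply: gr_combS => //; apply: (gr_zero grS). Qed.

Lemma msupp_sum_widen (r : seq 'X_{1..n}) (p : {mpoly k[n]}) (f : 'X_{1..n} -> S) :
  uniq r -> {subset msupp p <= r} ->
  \sum_(m <- msupp p) p@_m *: f m = \sum_(m <- r) p@_m *: f m.
Proof.
move=> ur pr; rewrite [RHS](bigID (mem (msupp p))) /= [X in _ + X]big1 ?addr0; last first.
  by move=> m /memN_msupp_eq0 ->; rewrite scale0r.
rewrite -[RHS]big_filter; apply: perm_big; apply: uniq_perm; rewrite ?filter_uniq //.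
move=> m; rewrite mem_filter /=; case mp: (m \in msupp p) => //=.
by rewrite pr.
Qed.

Lemma pbw_linear : exists mon : {linear {mpoly k[n]} -> S}, forall m, mon 'X_[m] = pbw_mon m.
Proof.
pose f (p : {mpoly k[n]}) : S := \sum_(m <- msupp p) p@_m *: pbw_mon m.
have lf : linear f.
  move=> c p q; set r := undup (msupp p ++ msupp q ++ msupp (c *: p + q)).
  have ur : uniq r := undup_uniq _.
  rewrite /f !(msupp_sum_widen (r := r)) // => [|m mp|m mp|m mp];
    try by rewrite mem_undup !mem_cat mp ?orbT.
  rewrite scaler_sumr -big_split; apply: eq_bigr => m _ /=.
  by rewrite mcoeffD mcoeffZ scalerDl scalerA.
have [mon monE] := linear_function lf; exists mon => m.
by rewrite monE /f msuppX big_seq1 mcoeffX eqxx scale1r.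
Qed.

(** * Linear independence of the ordered monomials *)

Section Monomials.
Variable mon : {linear {mpoly k[n]} -> S}.
Hypothesis monX : forall m, mon 'X_[m] = pbw_mon m.

Lemma mon_sum p : mon p = \sum_(m <- msupp p) p@_m *: pbw_mon m.
Proof.
rewrite {1}[p]mpolyE linear_sum; apply: eq_bigr => m _.
by rewrite linearZ /= monX.
Qed.

Lemma mon_surj a : exists p, mon p = a.
Proof.
have sp := pbw_spanning a.
refine (sp (fun a => exists p : {mpoly k[n]}, mon p = a) _ _ _) => [|c u v [p <-] [q <-]|m _].
- by exists 0; rewrite linear0.
- by exists (c *: p + q); rewrite linearP.
by exists 'X_[m].
Qed.

Definition homog_part d (p : {mpoly k[n]}) : {mpoly k[n]} :=
  \sum_(m : 'X_{1..n < msize p}) ((mdeg m == d)%:R * p@_m) *: 'X_[m].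

Lemma mcoeff_homog_part d p m : (homog_part d p)@_m = (mdeg m == d)%:R * p@_m.
Proof.
have [mp|pm] := ltnP (mdeg m) (msize p).
  by rewrite (mcoeff_mpoly (fun m => (mdeg m == d)%:R * p@_m)).
rewrite (memN_msupp_eq0 (msize_mdeg_ge pm)) mulr0 raddf_sum /= big1 // => i _.
rewrite mcoeffZ mcoeffX; case: (_ =P m) => [e|_]; last by rewrite mulr0.
by have := bmdeg i; rewrite e ltnNge pm.
Qed.

Lemma sum_homog_part N p : (msize p <= N)%N -> \sum_(d < N) homog_part d p = p.
Proof.
move=> pN; apply/mpolyP => m; rewrite raddf_sum /=.
under eq_bigr do rewrite mcoeff_homog_part.
have [mp|pm] := ltnP (mdeg m) N.
  rewrite (bigD1 (Ordinal mp)) //= eqxx mul1r big1 ?addr0 // => d.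
  by rewrite -val_eqE /= eq_sym => /negPf ->; rewrite mul0r.
by rewrite (memN_msupp_eq0 (msize_mdeg_ge (leq_trans pN pm))) big1 // => d _; rewrite mulr0.
Qed.

Lemma mon_homog_part_gr d p : gr d (mon (homog_part d p)).
Proof.
rewrite linear_sum; apply: gr_sumS => m _; rewrite linearZ /= monX.
have [<-|_] := eqVneq (mdeg m) d; first exact/gr_scaleS/pbw_mon_gr.
by rewrite mul0r scale0r; apply: (gr_zero grS).
Qed.

Lemma gr_homog_part d p : gr d (mon p) -> mon p = mon (homog_part d p).
Proof.
(* N exceeds d even when p is small, so that the slot d from which [mon p] is subtracted belongs to
   the sum. *)
move=> gp; set N := maxn (msize p) d.+1.
pose s e := mon (homog_part e p) - (if e == d then mon p else 0).
have sg e : gr e (s e).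
  rewrite /s addrC -scaleN1r; apply: gr_combS; last exact: mon_homog_part_gr.
  by case: eqP => [->|_] //; apply: (gr_zero grS).
have dN : (d < N)%N by rewrite leq_maxr.
have s0 : \sum_(e < N) s e = 0.
  rewrite sumrB -linear_sum sum_homog_part ?leq_maxl //.
  rewrite (bigD1 (Ordinal dN)) //= eqxx big1 ?addr0 ?subrr // => e.
  by rewrite -val_eqE /= => /negPf ->.
have := gr_direct grS sg s0 dN; rewrite /s eqxx => /eqP.
by rewrite subr_eq0 eq_sym => /eqP.
Qed.

Lemma gr_dim d : dim_eq (gr d) 'C(d + n.-1, d).
Proof.
have [h [hdim hE]] := hilb; suff <- : h d = 'C(d + n.-1, d) by apply: hdim.
apply/eqP; rewrite -(Num.Theory.eqr_nat int); apply/eqP.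
apply: (@hilbert_series_qpa _ (fun i => (h i)%:R)) => i.
by rewrite prednK // -hE.
Qed.

(** The ordered monomials of degree d span S_d, and there are as many of them as monomials of degree
    d in n commuting variables. By the Hilbert series this is dim S_d, so they are independent. *)
Lemma mon_homog_inj d p : (forall m, mdeg m != d -> p@_m = 0) -> mon p = 0 -> p = 0.
Proof.
move=> pd p0; pose r := [seq s2m t | t : d.-tuple 'I_n <- enum (basis n d)].
have ur : uniq r := uniq_basis n d.
have rP m : (m \in r) = (mdeg m == d) by rewrite [RHS]basis_cover.
have sr : size r = 'C(d + n.-1, d) by have := size_basis n.-1 d; rewrite prednK.
have monr q : (forall m, mdeg m != d -> q@_m = 0) ->
    mon q = \sum_(t < 'C(d + n.-1, d)) q@_(nth 0%MM r t) *: pbw_mon (nth 0%MM r t).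
  move=> qd; rewrite mon_sum (msupp_sum_widen (r := r)) //.
    by rewrite (big_nth 0%MM) big_mkord sr.
  move=> m; rewrite mcoeff_msupp rP; apply: contraR => /qd ->; exact: eqxx.
have rdeg (t : 'I_('C(d + n.-1, d))) : mdeg (nth 0%MM r t) = d.
  by apply/eqP; rewrite -rP mem_nth ?sr.
have := @dim_eq_free _ _ _ _ (fun t : 'I_('C(d + n.-1, d)) => pbw_mon (nth 0%MM r t))
  (gr_dim d) (gr_zero grS d).
have hp q m : mdeg m != d -> (homog_part d q)@_m = 0.
  by move=> /negPf md; rewrite mcoeff_homog_part md mul0r.
move=> /(_ _ _ (fun t => p@_(nth 0%MM r t))) ind.
apply/mpolyP => m; rewrite mcoeff0.
have [md|] := eqVneq (mdeg m) d; last exact: pd.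
have mr : m \in r by rewrite rP md.
have it : (index m r < 'C(d + n.-1, d))%N by rewrite -sr index_mem.
have := ind _ _ _ (Ordinal it); rewrite /= nth_index //; apply.
- by move=> t; rewrite -{1}(rdeg t); apply: pbw_mon_gr.
- move=> u gu; have [q qu] := mon_surj u; rewrite -qu in gu *.
  exists (fun t => (homog_part d q)@_(nth 0%MM r t)).
  by rewrite (gr_homog_part gu) monr; last exact: hp.
by rewrite -monr.
Qed.

Lemma mon_inj : injective mon.
Proof.
move=> p q pq; apply/eqP; rewrite -subr_eq0; apply/eqP; set e := p - q.
have e0 : mon e = 0 by rewrite linearB pq subrr.
rewrite -(sum_homog_part (leqnn (msize e))) big1 // => d _.
apply: (@mon_homog_inj d).
  by move=> m /negPf md; rewrite mcoeff_homog_part md mul0r.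
by rewrite -gr_homog_part e0 //; apply: (gr_zero grS).
Qed.

Lemma pbw_clifford : exists co : {linear S -> {mpoly k[n]}}, pbw gr y co mon.
Proof.
have [f fK] := functional_choice _ mon_surj.
have lf : linear f by move=> c a b; apply: mon_inj; rewrite linearP !fK.
have [co coE] := linear_function lf; exists co.
have coK : cancel co mon by move=> a; rewrite coE fK.
have monK : cancel mon co by move=> p; apply: mon_inj; rewrite coK.
split=> //.
- by rewrite -[in LHS]pbw_mon0 -monX monK mpolyX0.
- move=> d a; split=> [ga m md|ha].
    rewrite -(coK a) in ga; rewrite (mon_inj (gr_homog_part ga)).
    by rewrite mcoeff_homog_part (negPf md) mul0r.
  rewrite -(coK a) mon_sum big_seq; apply: gr_sumS => m.
  rewrite mcoeff_msupp => am; apply: gr_scaleS.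
  have [<-|md] := eqVneq (mdeg m) d; first exact: pbw_mon_gr.
  by rewrite ha ?eqxx in am.
- exact: y_central.
move=> i a; apply: mon_inj; rewrite coK.
rewrite -[X in _ * X](coK a) [co a in RHS]mpolyE mon_sum mulr_suml linear_sum mulr_sumr.
apply: eq_bigr => m _.
by rewrite -scalerAr -scalerAl linearZ /= -mpolyXD monX pbw_mon_y.
Qed.

(** A monomial with an odd exponent has x_i as a left factor for the least such i. If all exponents
    are even, some y_i splits off, and it lies in the sum of the x_j S_1. *)
Lemma gr_succ_clifford d b : gr d.+1 b ->
  exists2 a : 'I_n -> S, (forall i, gr d (a i)) & b = \sum_i x i * a i.
Proof.
have comb u v c : (exists2 a : 'I_n -> S, (forall i, gr d (a i)) & u = \sum_i x i * a i) ->
    (exists2 a : 'I_n -> S, (forall i, gr d (a i)) & v = \sum_i x i * a i) ->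
    exists2 a : 'I_n -> S, (forall i, gr d (a i)) & c *: u + v = \sum_i x i * a i.
  move=> [a ga ->] [a' ga' ->]; exists (fun i => c *: a i + a' i).
    by move=> i; apply: gr_combS.
  rewrite scaler_sumr -big_split; apply: eq_bigr => i _ /=.
  by rewrite mulrDr scalerAr.
have zero : exists2 a : 'I_n -> S, (forall i, gr d (a i)) & 0 = \sum_i x i * a i.
  exists (fun=> 0); first by move=> i; apply: (gr_zero grS).
  by rewrite big1 // => i _; rewrite mulr0.
have [co H] := pbw_clifford; move=> gb.
have := (pbw_gr H d.+1 b).1 gb; rewrite -{2}(pbw_coK H b) mon_sum => bd.
rewrite big_seq; apply: (big_ind (fun b => exists2 a : 'I_n -> S,
  (forall i, gr d (a i)) & b = \sum_i x i * a i)) => // [u v|m].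
  by move=> uP vP; rewrite -[u]scale1r; apply: comb.
rewrite mcoeff_msupp => bm; rewrite -[_ *: _]addr0; apply: comb => //.
have md : mdeg m = d.+1.
  by apply/eqP; apply: contraNT bm => /bd ->.
have [i0 oi0|noodd] := pickP (fun i => odd (m i)).
  case: (@arg_minnP _ i0 (fun i : 'I_n => odd (m i)) (fun i => i : nat) oi0) => i oi imin.
  have m1 : (U_(i) <= m)%MM by rewrite lep1mP; case: (m i) oi.
  pose m' := (m - U_(i))%MM.
  have m'm : (m' + U_(i))%MM = m by rewrite submK.
  have m'e (j : 'I_n) : (j <= i)%N -> ~~ odd (m' j).
    rewrite mnmBE mnm1E leq_eqVlt => /orP[/eqP/val_inj ->|ji].
      by rewrite eqxx; case: (m i) oi => //= q; rewrite subn1.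
    rewrite -val_eqE /= gtn_eqF // subn0; apply/negP => /imin.
    by rewrite leqNgt ji.
  have m'd : mdeg m' = d by have := md; rewrite -m'm mdegD mdeg1 addn1 => -[].
  exists (fun j => if j == i then pbw_mon m' else 0).
    by move=> j; case: eqP => _; [rewrite -m'd; apply: pbw_mon_gr|apply: (gr_zero grS)].
  rewrite -{1}m'm pbw_mon_x // (bigD1 i) //= eqxx big1 ?addr0 // => j /negPf ->.
  by rewrite mulr0.
have [i mi] : exists i, (0 < m i)%N.
  apply/existsP; apply: contraT => /existsPn m0; have : mdeg m = 0%N; last by rewrite md.
  by rewrite mdegE big1 // => i _; apply/eqP; rewrite -leqn0 leqNgt.
have m2 : (1 < m i)%N by have := noodd i; case: (m i) mi => [|[]].
have mm : (m - U_(i) *+ 2 + U_(i) *+ 2)%MM = m by exact: (subm_double m2).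
have [a ga yE] := y_gen i.
have dd : (1 + mdeg (m - U_(i) *+ 2)%MM)%N = d.
  by have := md; rewrite -{1}mm mdegD mdegMn mdeg1; lia.
exists (fun j => a j * pbw_mon (m - U_(i) *+ 2)%MM).
  by move=> j; rewrite -dd; apply: (gr_mul grS) => //; apply: pbw_mon_gr.
rewrite -{1}mm pbw_mon_y yE mulr_suml.
by apply: eq_bigr => j _; rewrite mulrA.
Qed.

End Monomials.

Lemma calabi_yau_clifford :
  [pchar k] =i pred0 ->
  (forall p j, ext_dim gr (tail gr 1) p j ((p == n) && (j == - n%:Z))) ->
  calabi_yau gr n <-> odd n.
Proof.
move=> char0 extk; have [mon monX] := pbw_linear.
have [co H] := pbw_clifford monX.
have co_x i : co (x i) = 'X_i by rewrite -pbw_monU -monX (pbw_monK H).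
have xa i j : yideal co n (x i * x j + x j * x i).
  rewrite xx; apply: (big_ind (yideal co n)) => [|u v ju jv|m _].
  - exact: yideal0.
  - exact: yidealD.
  by rewrite -[y m]mulr1 scalerAr; apply: (yideal_y H).
have x2 i : yideal co n (x i * x i).
  have := yideal_comb (2%:R^-1) (xa i i) (@yideal0 _ _ _ co n).
  by rewrite addr0 -mulr2n -scaler_nat scalerA mulVf // scale1r.
have xt : ~ yideal co n (\prod_(i <- enum 'I_n) x i).
  move/(_ [multinom 1%N | _ < n]).
  rewrite -pbw_mon_top -monX (pbw_monK H) mcoeffX eqxx => one0.
  have /eqP : (1 : k) = 0 by apply: one0 => i _; rewrite mnmE.
  by rewrite oner_eq0.
have gs := gr_succ_clifford monX.
split; first exact: (even_not_calabi_yau H extk n_gt0 co_x xa x2 xt).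
exact: (odd_calabi_yau H extk n_gt0 co_x xa x2 xt gs).
Qed.

End CliffordBasis.

(** * The theorem *)

Section FreeAlgebraImage.
Import monalg.
Variables (k : fieldType) (n : nat) (S : algType k).
Variable phi : {lrmorphism free_alg k n -> S}.

Lemma free_alg_image_ind (P : S -> Prop) : P 0 -> P 1 ->
  (forall c u v, P u -> P v -> P (c *: u + v)) ->
  (forall i a, P a -> P (phi (gen_x k i) * a)) ->
  (forall i a, P a -> P (phi (gen_y k i) * a)) ->
  forall w, P (phi w).
Proof.
move=> P0 P1 Pc Px Py w; rewrite [w]monalgE linear_sum.
apply: (big_ind P) => // [u v Pu Pv|m _]; first by rewrite -[u]scale1r; apply: Pc.
have -> : (<< monalg.mcoeff m w *g m >> : free_alg k n) = monalg.mcoeff m w *: << m >>.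
  by rewrite -mul_malgC malgM_def fgmulUU mulr1 mul1m.
rewrite linearZ /= -[_ *: _]addr0; apply: (Pc) => //.
case: m => s; elim: s => [|i s IHs].
  have -> : << FMonom [::] >> = 1 :> free_alg k n.
    by rewrite -fmoneE.
  by rewrite rmorph1.
have -> : << FMonom (i :: s) >> = << fmu i >> * << FMonom s >> :> free_alg k n.
  rewrite malgM_def fgmulUU mulr1; congr << _ >>.
  by apply/eqP; rewrite fmP fmM fmU.
rewrite rmorphM; case: i => i; [exact: Px|exact: Py].
Qed.

Variable F : n.-tuple 'M[k]_n.
Hypothesis phi_rel : forall w, clifford_rel F w -> phi w = 0.

Lemma image_xx i j : phi (gen_x k i) * phi (gen_x k j) + phi (gen_x k j) * phi (gen_x k i) =
  \sum_m tnth F m i j *: phi (gen_y k m).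
Proof.
have /(etrans (esym (raddfB phi _ _)))/subr0_eq := phi_rel (Clifford_xx F i j).
move/(etrans (esym (raddfD phi _ _))) => e.
rewrite -!(rmorphM phi).
apply: (etrans e).
apply: (etrans (raddf_sum phi _ _ _)).
apply: eq_bigr => m _; exact: linearZ.
Qed.

Lemma image_xy i j : phi (gen_x k i) * phi (gen_y k j) = phi (gen_y k j) * phi (gen_x k i).
Proof.
have /(etrans (esym (raddfB phi _ _)))/subr0_eq := phi_rel (Clifford_xy F i j).
by rewrite -!(rmorphM phi).
Qed.

Lemma image_yy i j : phi (gen_y k i) * phi (gen_y k j) = phi (gen_y k j) * phi (gen_y k i).
Proof.
have /(etrans (esym (raddfB phi _ _)))/subr0_eq := phi_rel (Clifford_yy F i j).
by rewrite -!(rmorphM phi).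
Qed.

End FreeAlgebraImage.

Theorem theorem1p2 (k : closedFieldType) (k_char0 : [pchar k] =i pred0)
    (n : nat) (n_gt0 : (0 < n)%N)
    (S : algType k) (gr : nat -> S -> Prop) :
  clifford_quantum_polynomial n gr ->
  (calabi_yau gr n <-> odd n).
Proof.
move=> [[grS _ _ extk hilb] [F [_ freeF [phi [phi_surj phi_ker x_gr1 y_gr2]]]]].
pose x i := phi (gen_x k i); pose y i := phi (gen_y k i).
have phi_rel w : clifford_rel F w -> phi w = 0.
  by move=> rw; apply/phi_ker => I _ _ _; apply.
have two_neq0 : 2%:R != 0 :> k by have := k_char0 2; rewrite !inE /= => ->.
have xx i j : x i * x j + x j * x i = \sum_m tnth F m i j *: y m.
  exact: image_xx.
have xy i j : x i * y j = y j * x i by exact: (image_xy phi_rel).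
have yy i j : y i * y j = y j * y i by exact: (image_yy phi_rel).
have generated (P : S -> Prop) : P 0 -> P 1 ->
    (forall c u v, P u -> P v -> P (c *: u + v)) ->
    (forall i a, P a -> P (x i * a)) -> (forall i a, P a -> P (y i * a)) ->
    forall a, P a.
  move=> P0 P1 Pc Px Py a; have [w <-] := phi_surj a.
  exact: free_alg_image_ind.
have y_gen m : exists2 a : 'I_n -> S, (forall i, gr 1 (a i)) & y m = \sum_i x i * a i.
  (* [coord F m] is a linear form on all matrices, with value 1 on F_m and 0 on the other F_m'
     because F is free; the c_ij are its matrix entries. Hence the sum of c_ij (x_i x_j + x_j x_i)
     is y_m. *)
  pose c i j : k := coord F m (delta_mx i j).
  exists (fun i => \sum_j (c i j + c j i) *: x j).
    by move=> i; apply: (gr_sumS grS) => j _; apply: (gr_scaleS grS); apply: x_gr1.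
  have -> : \sum_i x i * (\sum_j (c i j + c j i) *: x j) =
      \sum_i \sum_j c i j *: (x i * x j + x j * x i).
    under eq_bigr do rewrite mulr_sumr.
    under [RHS]eq_bigr do under eq_bigr do rewrite scalerDr.
    under [RHS]eq_bigr do rewrite big_split.
    rewrite big_split /= [X in _ + X]exchange_big -big_split; apply: eq_bigr => i _ /=.
    rewrite -big_split; apply: eq_bigr => j _ /=.
    by rewrite -scalerAr scalerDl.
  under eq_bigr do under eq_bigr do rewrite xx scaler_sumr.
  under eq_bigr do rewrite exchange_big.
  rewrite exchange_big /=.
  have cF m' : \sum_i \sum_j c i j *: (tnth F m' i j *: y m') = (m' == m)%:R *: y m'.
    rewrite -(coord_free m' m freeF) -tnth_nth [in RHS](matrix_sum_delta (tnth F m')).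
    rewrite linear_sum scaler_suml; apply: eq_bigr => i _.
    rewrite linear_sum scaler_suml; apply: eq_bigr => j _.
    by rewrite [in RHS]linearZ /= scalerA mulrC.
  rewrite (bigD1 m) //= cF eqxx scale1r big1 ?addr0 // => m' /negPf m'm.
  by rewrite cF m'm scale0r.
exact: (calabi_yau_clifford two_neq0 grS x_gr1 y_gr2 xx xy yy generated n_gt0 hilb y_gen
  k_char0 extk).
Qed.
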